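(* Let $X$ be a manifold with an almost $s$-Kähler structure of rank two, $s\ge 2$. The Lie algebra bundle $\mathcal{L}^s_{\mathbb{R}}$ is the full real Lie subalgebra bundle of $\mathcal{L}^s_{\mathbb{C}}$ of operators which preserve the form $\langle\langle\ ,\ \rangle\rangle$, and its fibre is isomorphic to $\mathbf{su}(s+1,s+1)$.
   Context: Fix $s\ge 2$. An almost $s$-Kähler structure of rank two on a smooth manifold $X$ of dimension $2(s+1)$ consists of a Riemannian metric $\mathbf{g}$ and smooth two-forms $\omega_{jk}$, $j,k\in\{0,\dots,s\}$, such that: (i) $\omega_{01},\dots,\omega_{0s}$ are closed and around every point there are coordinates $x_1,x_2,y^j_1,y^j_2$ ($1\le j\le s$) with $\omega_{0j}=\sum_{i=1}^2 dx_i\wedge dy^j_i$ for all $j$; (ii) at every $p\in X$ there is an orthonormal basis $\{v_{ij}: i=1,2,\ j=0,\dots,s\}$ of $T^*_pX$ (an adapted coframe) with $\omega_{jk}=\sum_{i=1}^2 v_{ij}\wedge v_{ik}$ at $p$ for all $j,k$. Any two adapted coframes at $p$ are related by $v'_{ij}=\sum_l a_{il}v_{lj}$ with $(a_{il})\in \mathbf{O}(2)$; so the spaces $W_j=\langle v_{1j},v_{2j}\rangle$ are canonical. Choosing an orientation of $W_0$ at $p$ and using adapted coframes with $v_{10},v_{20}$ positively oriented determines the derivation $J$ of $\bigwedge^*T_p^*X$ with $J(v_{1j})=v_{2j}$, $J(v_{2j})=-v_{1j}$ (a determination of $J$), and the volume form $\Omega=v_{10}\wedge v_{20}\wedge\dots\wedge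 v_{1s}\wedge v_{2s}$. On $\bigwedge^*_{\mathbb{C}}T^*_pX$ let $E_{ij}$ be the wedge product with $v_{ij}$; $*$ denotes the adjoint with respect to the Hermitian metric $(\ ,\ )_p$ induced by $\mathbf{g}$. Put, for $j\neq k$, $L_{jk}=\sum_{i=1}^2E_{ij}E_{ik}$ (wedge with $\omega_{jk}$), $V_j=E_{1j}E_{2j}$ (wedge with the volume form of $W_j$), $\Lambda_{jk}=L_{jk}^*$, $A_j=V_j^*$. All Lie algebras have the commutator bracket. $\mathcal{L}^s_{\mathbb{R}}$ is the bundle of real Lie algebras with fibre at $p$ generated by all $L_{jk},V_j,\Lambda_{jk},A_j$ in $\mathrm{End}_{\mathbb{R}}(\bigwedge^*T_p^*X)$; $\mathcal{L}^s_{\mathbb{C}}=\mathcal{L}^s_{\mathbb{R}}\otimes_{\mathbb{R}}\mathbb{C}$ acts on $\bigwedge^*_{\mathbb{C}}T_p^*X$. On homogeneous forms put $\langle\alpha,\beta\rangle_p=(\sqrt{-1})^{\deg(\alpha)\deg(\beta)}(\alpha\wedge\overline{\beta},\Omega)_p$ and $\langle\langle\alpha,\beta\rangle\rangle_p=(\sqrt{-1})^{s+1+\deg\beta}\langle\alpha,\beta\rangle_p$; these extend to non-degenerate Hermitian inner products on $\bigwedge^*_{\mathbb{C}}T_p^*X$. An operator $\phi$ preserves $\langle\langle\ ,\ \rangle\rangle$ (in the infinitesimal sense) if $\langle\langle\phi(\alpha),\beta\rangle\rangle_p+\langle\langle\alpha,\phi(\beta)\rangle\rangle_p=0$ for all $\alpha,\beta$.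 *)

(* Defs.v *)
From HB Require Import structures.
From mathcomp Require Import all_boot all_order all_algebra.
From mathcomp Require Import complex.
From mathcomp Require Import all_classical all_reals all_analysis.

Set Implicit Arguments.
Unset Strict Implicit.
Unset Printing Implicit Defensive.

Import Order.TTheory GRing.Theory Num.Theory.
Import numFieldNormedType.Exports.

Local Open Scope classical_set_scope.
Local Open Scope ring_scope.

Section Manifold.
Variables (R : realType) (n : nat).

Fixpoint Ck (k : nat) (U : set 'rV[R]_n) (f : 'rV[R]_n -> R^o) : Prop :=
  match k with
  | 0 => forall x, U x -> {for x, continuous f}
  | k'.+1 => (forall x, U x -> differentiable f x) /\
             (forall v : 'rV[R]_n, Ck k' U ('D_v f))
  end.

Definition smooth_on (U : set 'rV[R]_n) (f : 'rV[R]_n -> R^o) : Prop :=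
  forall k, Ck k U f.

(* The two maps are total; only their values on the domain and on its image
   are meaningful. *)
Record chart (X : topologicalType) := Chart {
  chart_dom : set X;
  chart_map : X -> 'rV[R]_n;
  chart_inv : 'rV[R]_n -> X;
  chart_dom_open : open chart_dom;
  chart_img_open : open (chart_map @` chart_dom);
  chart_mapK : forall p, chart_dom p -> chart_inv (chart_map p) = p;
  chart_map_cts : {within chart_dom, continuous chart_map};
  chart_inv_cts : {within chart_map @` chart_dom, continuous chart_inv}
}.

Definition transition (X : topologicalType) (c c' : chart X) :
    'rV[R]_n -> 'rV[R]_n :=
  fun x => chart_map c' (chart_inv c x).

Definition smooth_transition (X : topologicalType) (c c' : chart X) : Prop :=
  forall i : 'I_n,
    smooth_on (chart_map c @` (chart_dom c `&` chart_dom c'))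
              (fun x => transition c c' x 0 i).

Record manifold := Manifold {
  points :> topologicalType;
  points_hausdorff : hausdorff_space points;
  points_second_countable : @second_countable points;
  atlas : set (chart points);
  atlas_cover : forall p : points, exists2 c, atlas c & chart_dom c p;
  atlas_smooth : forall c c', atlas c -> atlas c' -> smooth_transition c c';
  atlas_maximal : forall c,
    (forall c', atlas c' -> smooth_transition c c' /\ smooth_transition c' c) ->
    atlas c
}.

(* The components of a 2-tensor field in every chart: [t c p] is the Gram
   matrix at [p] with respect to the coordinate vectors of [c]; it is
   meaningful when [c] is in the atlas and [p] in its domain. Tangent vectors
   are rows and [jacobian] acts on them on the right. *)
Definition components (X : manifold) := chart X -> X -> 'M[R]_n.

Definition smooth_tensor (X : manifold) (t : components X) : Prop :=
  (forall c, atlas c -> forall a b : 'I_n,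
     smooth_on (chart_map c @` chart_dom c) (fun x => t c (chart_inv c x) a b))
  /\
  (forall c c' p, atlas c -> atlas c' -> chart_dom c p -> chart_dom c' p ->
     let Jac := jacobian (transition c c') (chart_map c p) in
     t c p = Jac *m t c' p *m Jac^T).

Definition riemannian (X : manifold) (g : components X) : Prop :=
  smooth_tensor g /\
  forall c p, atlas c -> chart_dom c p ->
    (g c p)^T = g c p /\
    forall u : 'rV[R]_n, u != 0 -> 0 < (u *m g c p *m u^T) 0 0.

Definition two_form (X : manifold) (w : components X) : Prop :=
  smooth_tensor w /\
  forall c p, atlas c -> chart_dom c p -> (w c p)^T = - w c p.

Definition closed_form (X : manifold) (w : components X) : Prop :=
  forall c p, atlas c -> chart_dom c p -> forall i j k : 'I_n,
    let d (a b e : 'I_n) : R :=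
      'D_(delta_mx 0 a) (fun x => w c (chart_inv c x) b e : R^o)
        (chart_map c p) in
    d i j k + d j k i + d k i j = 0.

(* The Gram matrix of the two-form (u ∧ v)(a, b) = u(a)v(b) - u(b)v(a), for
   covectors u and v given by their rows of coordinates. *)
Definition wedge_cov (u v : 'rV[R]_n) : 'M[R]_n := u^T *m v - v^T *m u.

End Manifold.

Section AlmostSKahler.
Variables (R : realType) (s : nat).

Notation dimX := (2 * s.+1)%N.

(* A family indexed by i = 1, 2 and j = 0, ..., s is indexed here by
   'I_2 and 'I_s.+1, the two values of 'I_2 standing for 1 and 2. *)
Definition coframe := 'I_2 -> 'I_s.+1 -> 'rV[R]_dimX.

(* The coordinates of a chart are labelled x_i = z_(i, 0) and y^j_i = z_(i, j)
   for j > 0. *)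
Definition dz : coframe := fun i j => delta_mx 0 (mxvec_index i j).

(* [invmx G] is the Gram matrix of the dual metric on covectors. *)
Definition adapted_at (G : 'M[R]_dimX) (w : 'I_s.+1 -> 'I_s.+1 -> 'M[R]_dimX)
    (v : coframe) : Prop :=
  (forall i j i' j', (v i j *m invmx G *m (v i' j')^T) 0 0
                     = ((i == i') && (j == j'))%:R) /\
  (forall j k, w j k = \sum_(i < 2) wedge_cov (v i j) (v i k)).

Record almost_sKahler (X : manifold R dimX) := AlmostSKahler {
  metric : components X;
  omega : 'I_s.+1 -> 'I_s.+1 -> components X;
  metric_riemannian : riemannian metric;
  omega_two_form : forall j k, two_form (omega j k);
  omega_closed : forall j, j != ord0 -> closed_form (omega ord0 j);
  omega_coordinates : forall p : X, exists c,
    [/\ atlas c, chart_dom c p &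
        forall q, chart_dom c q -> forall j, j != ord0 ->
          omega ord0 j c q = \sum_(i < 2) wedge_cov (dz i ord0) (dz i j)];
  omega_adapted : forall c (p : X), atlas c -> chart_dom c p ->
    exists v, adapted_at (metric c p) (fun j k => omega j k c p) v
}.

(* Adapted coframes at [p], their covectors being written in the basis of
   coordinate differentials of [c]. *)
Definition adapted_coframe (X : manifold R dimX) (K : almost_sKahler X)
    (c : chart R dimX X) (p : X) (v : coframe) : Prop :=
  adapted_at (metric K c p) (fun j k => omega K j k c p) v.

End AlmostSKahler.

(* A form with coefficients in F is given by its coordinates in the basis of
   the e_S = e_{i_1} ∧ ... ∧ e_{i_k}, with S = {i_1 < ... < i_k}. *)
Notation ext F n := {ffun {set 'I_n} -> F^o}.

Section Exterior.
Variables (F : fieldType) (n : nat).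

Definition wedge_sign (S T : {set 'I_n}) : F :=
  (-1) ^+ #|[set ab : 'I_n * 'I_n |
              [&& ab.1 \in S, ab.2 \in T & (ab.2 < ab.1)%N]]%SET|.

Definition wedge (a b : ext F n) : ext F n :=
  [ffun U : {set 'I_n} => \sum_(S : {set 'I_n} | S \subset U)
     wedge_sign S (U :\: S) * a S * b (U :\: S)].

Definition ext1 : ext F n := [ffun S : {set 'I_n} => (S == finset.set0)%:R].

Definition covector (v : 'rV[F]_n) : ext F n :=
  [ffun S : {set 'I_n} => \sum_(i < n) (S == [set i]%SET)%:R * v 0 i].

Definition wedge_op (a : ext F n) : 'End(ext F n) := linfun (wedge a).

Definition homogeneous_part (k : nat) (a : ext F n) : ext F n :=
  [ffun S : {set 'I_n} => if #|S| == k then a S else 0].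

(* If Q is the Gram matrix of the e_i, this is the inner product of
   e_S and e_T. *)
Definition ext_gram (Q : 'M[F]_n) (S T : {set 'I_n}) : F :=
  match #|S| =P #|T| with
  | ReflectT e =>
      \det (\matrix_(a < #|S|, b < #|S|)
              Q (enum_val a) (enum_val (cast_ord e b)))
  | ReflectF _ => 0
  end.

Definition op_bracket (f g : 'End(ext F n)) : 'End(ext F n) :=
  ((f \o g) - (g \o f))%VF.

End Exterior.

Section Complex.
Variables (R : realType) (n : nat).

Definition ext_of_real (a : ext R n) : ext R[i] n :=
  [ffun S : {set 'I_n} => (a S)%:C%C].
Definition ext_Re (a : ext R[i] n) : ext R n :=
  [ffun S : {set 'I_n} => complex.Re (a S)].
Definition ext_Im (a : ext R[i] n) : ext R n :=
  [ffun S : {set 'I_n} => complex.Im (a S)].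
Definition ext_conj (a : ext R[i] n) : ext R[i] n :=
  [ffun S : {set 'I_n} => conjc (a S)].

Definition imag : R[i] := 'i%C.

(* The operator phi ⊗ 1 of the complexification. *)
Definition complexify (phi : 'End(ext R n)) : 'End(ext R[i] n) :=
  linfun (fun a => ext_of_real (phi (ext_Re a))
                   + imag *: ext_of_real (phi (ext_Im a)) : ext R[i] n).

(* The Hermitian metric on complex forms, linear in the first argument, for
   the inner product with Gram matrix Q on covectors. *)
Definition herm (Q : 'M[R]_n) (a b : ext R[i] n) : R[i] :=
  \sum_(S : {set 'I_n}) \sum_(T : {set 'I_n})
    a S * conjc (b T) * (ext_gram Q S T)%:C%C.

Definition herm_adjoint (Q : 'M[R]_n) (phi psi : 'End(ext R[i] n)) : Prop :=
  forall a b, herm Q (phi a) b = herm Q a (psi b).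

Definition real_lie_subalgebra (A : set 'End(ext R n)) : Prop :=
  [/\ A 0,
      forall f g, A f -> A g -> A (f + g),
      forall (r : R) f, A f -> A (r *: f)
    & forall f g, A f -> A g -> A (op_bracket f g)].

Definition complex_span (A : set 'End(ext R n)) : set 'End(ext R[i] n) :=
  [set phi | exists f g, [/\ A f, A g &
               phi = complexify f + imag *: complexify g]].

Definition preserves (h : ext R[i] n -> ext R[i] n -> R[i])
    (phi : 'End(ext R[i] n)) : Prop :=
  forall a b, h (phi a) b + h a (phi b) = 0.

Definition su (p q : nat) : set 'M[R[i]]_(p + q) :=
  let Ipq : 'M[R[i]]_(p + q) := block_mx 1%:M 0 0 (- 1%:M) in
  [set M | (map_mx conjc M)^T *m Ipq + Ipq *m M = 0 /\ \tr M = 0].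

Arguments su : clear implicits.

(* Isomorphism of real Lie algebras, A carrying the commutator bracket. *)
Definition isomorphic_to_su (A : set 'End(ext R n)) (p q : nat) : Prop :=
  exists f : 'End(ext R n) -> 'M[R[i]]_(p + q),
    [/\ set_bij A (su p q) f,
        forall x y, A x -> A y -> f (x + y) = f x + f y,
        forall (r : R) x, A x -> f (r *: x) = r%:C%C *: f x
      & forall x y, A x -> A y ->
          f (op_bracket x y) = f x *m f y - f y *m f x].

End Complex.

Section Fibre.
Variables (R : realType) (s : nat).
Variables (G : 'M[R]_(2 * s.+1)) (v : coframe R s).

Notation dimX := (2 * s.+1)%N.

Definition E_op (i : 'I_2) (j : 'I_s.+1) : 'End(ext R dimX) :=
  wedge_op (covector (v i j)).

Definition L_op (j k : 'I_s.+1) : 'End(ext R dimX) :=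
  (\sum_(i < 2) (E_op i j \o E_op i k)%VF).

Definition V_op (j : 'I_s.+1) : 'End(ext R dimX) :=
  (E_op ord0 j \o E_op ord_max j)%VF.

(* [psi] is the real operator whose complexification is the Hermitian adjoint
   of the complexification of [phi]. *)
Definition is_adjoint (phi psi : 'End(ext R dimX)) : Prop :=
  herm_adjoint (invmx G) (complexify phi) (complexify psi).

Definition lie_generators : set 'End(ext R dimX) :=
  [set phi |
    (exists j k, j != k /\ (phi = L_op j k \/ is_adjoint (L_op j k) phi)) \/
    (exists j, phi = V_op j \/ is_adjoint (V_op j) phi)].

Definition LR_fibre : set 'End(ext R dimX) :=
  smallest (@real_lie_subalgebra R dimX) lie_generators.

(* LR ⊗ C, realized by its (faithful) action on complex forms. *)
Definition LC_fibre : set 'End(ext R[i] dimX) := complex_span LR_fibre.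

Definition volume_form : ext R dimX :=
  \big[@wedge R dimX / ext1 R dimX]_(j < s.+1)
    wedge (covector (v ord0 j)) (covector (v ord_max j)).

Definition pairing_term (k l : nat) (a b : ext R[i] dimX) : R[i] :=
  imag R ^+ (k * l) *
    herm (invmx G) (wedge (homogeneous_part k a)
                          (ext_conj (homogeneous_part l b)))
         (ext_of_real volume_form).

(* ⟨a, b⟩ and ⟨⟨a, b⟩⟩, extended from homogeneous forms by sesquilinearity. *)
Definition pairing (a b : ext R[i] dimX) : R[i] :=
  \sum_(k < dimX.+1) \sum_(l < dimX.+1) pairing_term k l a b.

Definition pairing2 (a b : ext R[i] dimX) : R[i] :=
  \sum_(l < dimX.+1)
    imag R ^+ (s + 1 + l) * pairing a (homogeneous_part l b).

End Fibre.

(* Main.v *)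
Require Import Defs.
From HB Require Import structures.
From mathcomp Require Import all_boot all_order all_algebra.
From mathcomp Require Import complex.
From mathcomp Require Import all_classical all_reals all_analysis.
From mathcomp Require Import ring zify.
Import Order.TTheory GRing.Theory Num.Theory.
Local Open Scope classical_set_scope.
Local Open Scope ring_scope.

Set Implicit Arguments.
Unset Strict Implicit.
Unset Printing Implicit Defensive.

(**
The wedge products with the [v_ij] and the dual contractions satisfy the
canonical anticommutation relations, and in the basis of the [e_S] the pairing
is [<<a, b>> = k * top (a /\ C (conj b))] with [k] nonzero, [top] the coefficient
of the volume form and [C] diagonal.  A product [P] of two wedge products or of
two contractions satisfies [top (P a /\ b) = top (a /\ P b)] and
[C P = - P C], so the generators preserve the pairing, hence so does the real
algebra [LR].  If [f + i g] with [f, g] in [LR] preserves it too, then [i g] and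
[g] both do, and [g = 0] because the pairing is non-degenerate and sesquilinear.

For the isomorphism, put [w_j = v_1j + i v_2j].  The wedge products with [w_j]
and the contractions with [conj w_j] form a family [alpha_p] of [2 (s + 1)]
anticommuting operators with a dual family [beta_p], and
[M |-> sum M_pq alpha_p beta_q] is a faithful representation of the Lie algebra
of matrices.  It sends [su] of the split form [(0 1; 1 0)] onto [LR]: the
generators correspond to the elementary antihermitian off-diagonal blocks
[e_jk - e_kj] and [i e_jj], and for [s >= 2] these generate the whole algebra.
*)

(** * Exterior algebra *)

(** Forms are coordinates in a chart basis, which need not be orthonormal, so the inner product is a
    matrix of Gram determinants and the adjoint of a wedge product is not a mere transpose. Laplace
    expansion identifies it with a metric contraction; the Lie algebra is then handled through the
    anticommutation relations alone.

    The [w_j] are isotropic for the complex bilinear extension of the metric, so the [alpha_p]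
    anticommute although they mix wedge products and contractions. They also share one eigenvalue
    under [J], so the products [alpha_p beta_q] commute with [J], as the generators do: this is
    gl(2(s+1)) inside the orthogonal algebra of all quadratic expressions in the wedge products and
    contractions.

    The split form comes from reality. Complex conjugation sends [alpha_p] to twice [beta_p'], where
    [p'] is the index of [p] in the other half. Conjugating [sum M_pq alpha_p beta_q] and restoring
    the order of the factors gives the operator of [- F M^* F], with [F = (0 1; 1 0)], plus the
    scalar [conj (tr M)]. The operator is thus real exactly when [M^* F + F M = 0] and
    [tr M = 0]. *)

HB.instance Definition _ (K : fieldType) (V : vectType K) :=
  GRing.Zmodule_isPzRing.Build 'End(V) (@comp_lfunA _ _ _ _ _)
    (@comp_lfun1l _ _ _) (@comp_lfun1r _ _ _)
    (@comp_lfunDl _ _ _ _) (@comp_lfunDr _ _ _ _).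

Section Endomorphisms.
Variables (K : fieldType) (V : vectType K).
Implicit Types f g : 'End(V).

Lemma mul_lfunE f g x : (f * g) x = f (g x).
Proof. exact: comp_lfunE. Qed.

Lemma one_lfunE (x : V) : (1 : 'End(V)) x = x.
Proof. exact: id_lfunE. Qed.

Lemma lfunL f (k : K) (x y : V) : f (k *: x + y) = k *: f x + f y.
Proof. exact: linearP. Qed.

Lemma lfunD f (x y : V) : f (x + y) = f x + f y.
Proof. exact: linearD. Qed.

Lemma lfunN f (x : V) : f (- x) = - f x.
Proof. exact: linearN. Qed.

Lemma lfun0 f : f 0 = 0 :> V.
Proof. exact: linear0. Qed.

Lemma scale_lfunAl (k : K) f g : k *: f * g = k *: (f * g).
Proof. exact: (esym (comp_lfunZl _ _ _)). Qed.

Lemma scale_lfunAr (k : K) f g : f * (k *: g) = k *: (f * g).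
Proof. exact: (esym (comp_lfunZr _ _ _)). Qed.

End Endomorphisms.

Section Exterior.
Variables (F : fieldType) (n : nat).
Implicit Types (i j k : 'I_n) (S T U : {set 'I_n}) (a b : ext F n).

(** The sign of moving [e_i] to its place among the factors of [e_S]. Only elements strictly below
    [i] count, so [i] itself may lie in [S] or not. *)
Definition eps i S : F := \prod_(k in S) (-1) ^+ (k < i)%N.

Lemma eps_setU1 i j S : j \notin S -> eps i (j |: S) = (-1) ^+ (j < i)%N * eps i S.
Proof. by move=> jS; rewrite /eps big_setU1. Qed.

Lemma eps_setD1 i j S : j \in S -> eps i S = (-1) ^+ (j < i)%N * eps i (S :\ j).
Proof. by move=> jS; rewrite -[in LHS](finset.setD1K jS) eps_setU1 // !inE eqxx. Qed.

Lemma eps_setD1id i S : eps i (S :\ i) = eps i S.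
Proof.
case: (boolP (i \in S)) => iS; first by rewrite (@eps_setD1 i i S iS) ltnn mul1r.
by congr eps; apply/setP => j; rewrite !inE; case: eqP => // ->; rewrite (negPf iS).
Qed.

Lemma eps_setU1id i S : eps i (i |: S) = eps i S.
Proof.
by rewrite -[LHS]eps_setD1id -[RHS]eps_setD1id; congr eps; apply/setP => j; rewrite !inE; case: eqP.
Qed.

Lemma epsK i S x : eps i S * (eps i S * x) = x.
Proof.
rewrite mulrA -expr2 /eps -prodrXl big1 ?mul1r // => k _.
by rewrite -exprM mulnC exprM sqrrN expr1n expr1n.
Qed.

Lemma sgn_ltnC i j : i != j -> (-1) ^+ (j < i)%N = - (-1) ^+ (i < j)%N :> F.
Proof.
rewrite -val_eqE /=; case: ltngtP => // _ _ //=; by rewrite ?expr0 ?expr1 ?opprK.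
Qed.

Lemma wedge_signE S T : wedge_sign F S T = \prod_(i in S) eps i T.
Proof.
rewrite /wedge_sign /eps -sum1_card -prodrXr.
rewrite (eq_bigr (fun i => \prod_(j in T) (if (j < i)%N then -1 else 1))); last first.
  by move=> i _; apply: eq_bigr => j _; case: ifP.
under eq_bigr do rewrite expr1.
rewrite pair_big_dep /= -[RHS]big_mkcondr /=; apply: eq_bigl => -[i j] /=.
by rewrite inE /= andbA.
Qed.

(** Exterior multiplication by [e_i] and, below, contraction with the dual coordinate vector. Both
    are independent of the metric. *)
Definition create_fun i a : ext F n :=
  [ffun U : {set 'I_n} => if i \in U then eps i U * a (U :\ i) else 0].
Definition annih_fun i a : ext F n :=
  [ffun U : {set 'I_n} => if i \in U then 0 else eps i U * a (i |: U)].

Lemma create_fun_linear i : linear (create_fun i).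
Proof.
move=> k a b; apply/ffunP => U; rewrite !ffunE; case: ifP => _; last by rewrite scaler0 addr0.
by rewrite mulrDr -mulr_algl !mulr_algl scalerAr.
Qed.
HB.instance Definition _ i :=
  GRing.isLinear.Build F (ext F n) (ext F n) _ (create_fun i) (create_fun_linear i).

Lemma annih_fun_linear i : linear (annih_fun i).
Proof.
move=> k a b; apply/ffunP => U; rewrite !ffunE; case: ifP => _; first by rewrite scaler0 addr0.
by rewrite mulrDr -mulr_algl !mulr_algl scalerAr.
Qed.
HB.instance Definition _ i :=
  GRing.isLinear.Build F (ext F n) (ext F n) _ (annih_fun i) (annih_fun_linear i).

Definition create i : 'End(ext F n) := linfun (create_fun i).
Definition annih i : 'End(ext F n) := linfun (annih_fun i).

Lemma createE i a U : create i a U = if i \in U then eps i U * a (U :\ i) else 0.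
Proof. by rewrite lfunE /= ffunE. Qed.

Lemma annihE i a U : annih i a U = if i \in U then 0 else eps i U * a (i |: U).
Proof. by rewrite lfunE /= ffunE. Qed.

Lemma create_anticomm i j a : create i (create j a) = - create j (create i a).
Proof.
apply/ffunP => U; rewrite ffunE !createE.
have [<-|ij] := eqVneq i j.
  by rewrite !inE eqxx /= mulr0; case: ifP => _; rewrite oppr0.
rewrite !inE ij eq_sym ij /=.
case: (boolP (i \in U)) => iU; case: (boolP (j \in U)) => jU /=; rewrite ?mulr0 ?oppr0 //.
rewrite (eps_setD1 i jU) (eps_setD1 j iU) (sgn_ltnC ij).
have -> : U :\ i :\ j = U :\ j :\ i by apply/setP => k; rewrite !inE andbCA.
by rewrite !mulrA !mulNr; congr (- (_ * _)); rewrite -!mulrA; congr (_ * _); rewrite mulrC.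
Qed.

Lemma annih_anticomm i j a : annih i (annih j a) = - annih j (annih i a).
Proof.
apply/ffunP => U; rewrite ffunE !annihE.
have [<-|ij] := eqVneq i j.
  by rewrite !inE eqxx /= mulr0; case: ifP => _; rewrite oppr0.
rewrite !inE (negPf ij) eq_sym (negPf ij) /=.
case: (boolP (i \in U)) => iU; case: (boolP (j \in U)) => jU /=; rewrite ?mulr0 ?oppr0 //.
rewrite (eps_setU1 _ jU) (eps_setU1 _ iU) (sgn_ltnC ij).
have -> : j |: (i |: U) = i |: (j |: U) by rewrite finset.setUCA.
rewrite !mulrA !mulrN !mulNr opprK; congr (_ * _).
by rewrite mulrAC [RHS]mulrC mulrA.
Qed.

Lemma annih_create i j a :
  annih i (create j a) = (i == j)%:R *: a - create j (annih i a).
Proof.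
apply/ffunP => U; rewrite !ffunE !annihE !createE !annihE.
have [<-|ij] := eqVneq i j.
  rewrite !inE eqxx /= eps_setU1id eps_setD1id; case: (boolP (i \in U)) => iU.
  - by rewrite finset.setD1K // epsK scale1r subrr.
  - by rewrite finset.setU1K // epsK scale1r subr0.
rewrite !inE eq_sym (negPf ij) /= scale0r sub0r.
case: (boolP (i \in U)) => iU; case: (boolP (j \in U)) => jU /=; rewrite ?mulr0 ?oppr0 //.
rewrite (eps_setD1 i jU) (eps_setU1 _ iU).
have -> : (i |: U) :\ j = i |: U :\ j.
  by apply/setP => k; rewrite !inE; case: (eqVneq k i) => // ->; rewrite ij.
by rewrite (sgn_ltnC ij) !mulNr -[_ * eps j U * _]mulrA mulrACA -expr2 sqrr_sign mul1r mulrCA.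
Qed.

Definition mono S : ext F n := [ffun T : {set 'I_n} => (T == S)%:R].

Lemma ext_sum a : a = \sum_S a S *: mono S.
Proof.
apply/ffunP => T; rewrite sum_ffunE (bigD1 T) //= big1 ?addr0 => [|S ST].
  by rewrite !ffunE eqxx [RHS]mulr1.
by rewrite !ffunE eq_sym (negPf ST) [LHS]mulr0.
Qed.

Lemma create_mono i S : i \in S -> create i (mono (S :\ i)) = eps i S *: mono S.
Proof.
move=> iS; apply/ffunP => U; rewrite createE !ffunE.
case: (boolP (i \in U)) => iU; last first.
  by case: eqP => [US|_]; [rewrite US iS in iU | rewrite [RHS]mulr0].
have -> : (U :\ i == S :\ i) = (U == S).
  apply/eqP/eqP => [US|-> //].
  by rewrite -(finset.setD1K iU) US finset.setD1K.
by case: eqP => [->|_] //; rewrite [RHS]mulr0 mulr0.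
Qed.

(** Up to sign every [e_S] arises from 1 by successive [create]. Identities that are linear in the
    left factor of [wedge] are reduced by this to their behaviour under [create], with no sum over
    subsets. *)
Lemma ext_ind (P : ext F n -> Prop) :
  (forall (c : F) a b, P a -> P b -> P (c *: a + b)) -> P (ext1 F n) ->
  (forall i a, P a -> P (create i a)) -> forall a, P a.
Proof.
move=> PL P1 Pc.
have P0 : P 0 by rewrite -(subrr (ext1 F n)) addrC -scaleN1r; apply: PL.
have Pm S : P (mono S).
  elim: {S}_.+1 {-2}S (ltnSn #|S|) => // m IH S Sm.
  have [->|[i iS]] := set_0Vmem S; first exact: P1.
  have -> : mono S = eps i S *: create i (mono (S :\ i)) + 0.
    rewrite create_mono // addr0 scalerA.
    by rewrite -[_ * _]mulr1 -mulrA epsK scale1r.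
  by apply: PL => //; apply/Pc/IH; rewrite (cardsD1 i) iS in Sm.
move=> a; rewrite (ext_sum a); elim/big_rec: _ => // S b _ Pb.
exact: PL.
Qed.

Lemma wedge_linearr a : linear (wedge a).
Proof.
move=> k b b'; apply/ffunP => U; rewrite !ffunE scaler_sumr -big_split.
apply: eq_bigr => S _; rewrite !ffunE mulrDr; congr (_ + _).
exact: mulrCA.
Qed.
HB.instance Definition _ a :=
  GRing.isLinear.Build F (ext F n) (ext F n) _ (wedge a) (wedge_linearr a).

Lemma wedge_linearl (k : F) a a' b : wedge (k *: a + a') b = k *: wedge a b + wedge a' b.
Proof.
 apply/ffunP => U; rewrite !ffunE scaler_sumr -big_split.
apply: eq_bigr => S _; rewrite !ffunE mulrDr mulrDl; congr (_ + _).
have mulCA (x y z w : F) : x * (y * z) * w = y * (x * z * w) by rewrite !mulrA (mulrC x).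
exact: mulCA.
Qed.

Lemma wedgeNl a b : wedge (- a) b = - wedge a b.
Proof.
by apply/ffunP => U; rewrite !ffunE -sumrN; apply: eq_bigr => S _; rewrite !ffunE mulrN mulNr.
Qed.

Lemma wedge0l b : wedge 0 b = 0 :> ext F n.
Proof.
by apply/ffunP => U; rewrite !ffunE big1 // => S _; rewrite !ffunE mulr0 mul0r.
Qed.

Lemma wedge_opE a b : wedge_op a b = wedge a b.
Proof. by rewrite lfunE. Qed.

Lemma wedge1l b : wedge (ext1 F n) b = b.
Proof.
apply/ffunP => U; rewrite ffunE (bigD1 finset.set0) ?finset.sub0set //= big1 ?addr0 => [|S /andP[_ /negPf S0]].
  by rewrite ffunE eqxx mulr1 wedge_signE big_set0 mul1r finset.setD0.
by rewrite ffunE S0 mulr0 mul0r.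
Qed.

(** Only subsets containing [i] contribute on the left, and removing [i] matches them with those on
    the right. Together with [wedge1l] and linearity this determines the product, so later
    identities need not return to its definition. *)
Lemma wedge_createl i a b : wedge (create i a) b = create i (wedge a b).
Proof.
apply/ffunP => U; rewrite createE !ffunE; case: ifP => iU; last first.
  rewrite big1 // => S /fintype.subsetP SU; rewrite createE; case: ifP => [/SU|]; first by rewrite iU.
  by rewrite mulr0 mul0r.
rewrite (bigID (fun S : {set 'I_n} => i \in S)) /= [X in _ + X]big1 ?addr0; last first.
  by move=> S /andP[_ /negPf iS]; rewrite createE iS mulr0 mul0r.
rewrite (reindex_onto (fun S : {set 'I_n} => i |: S) (fun S => S :\ i)) /=; last first.
  by move=> S /andP[_]; apply: finset.setD1K.
rewrite mulr_sumr; apply: eq_big => [S|S /andP[/andP[SU iS] /eqP SE]].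
  rewrite finset.subUset finset.sub1set iU setU11 andbT /= finset.subsetD1.
  case: (S \subset U) => //=; apply/eqP/idP => [<-|iS]; first by rewrite !inE eqxx.
  by rewrite finset.setU1K.
have iS' : i \notin S by rewrite -SE !inE eqxx.
rewrite createE setU11 finset.setU1K // !wedge_signE big_setU1 //= eps_setU1id.
have -> : U :\ i :\: S = U :\: (i |: S) by apply/setP => k; rewrite !inE; case: eqP; case: (k \in S).
have -> : eps i U = eps i (U :\: (i |: S)) * eps i S.
  rewrite /eps (big_setID (i |: S)) /= mulrC (finset.setIidPr SU); congr (_ * _).
  exact: eps_setU1id.
by rewrite !mulrA; congr (_ * _ * _); rewrite -!mulrA; congr (_ * _); rewrite mulrC.
Qed.

(** The parity involution: the sign produced when an odd operator passes the left factor of a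
    product. *)
Definition grade a : ext F n := [ffun S : {set 'I_n} => (-1) ^+ #|S| * a S].

Lemma grade_linear : linear grade.
Proof.
by move=> k a b; apply/ffunP => S; rewrite !ffunE mulrDr -scalerAr.
Qed.

Lemma grade1 : grade (ext1 F n) = ext1 F n.
Proof.
by apply/ffunP => S; rewrite !ffunE; case: eqP => [->|_]; rewrite ?mulr0 // cards0 mul1r.
Qed.

Lemma gradeK : involutive grade.
Proof. by move=> a; apply/ffunP => S; rewrite !ffunE signrMK. Qed.

Lemma grade_create i a : grade (create i a) = - create i (grade a).
Proof.
apply/ffunP => S; rewrite !ffunE !createE ffunE; case: ifP => iS; last by rewrite mulr0 oppr0.
by rewrite (cardsD1 i) iS exprS mulN1r mulNr mulrCA.
Qed.

Lemma grade_annih i a : grade (annih i a) = - annih i (grade a).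
Proof.
apply/ffunP => S; rewrite !ffunE !annihE ffunE; case: ifP => iS; first by rewrite mulr0 oppr0.
by rewrite cardsU1 iS exprS mulN1r mulNr mulrN opprK mulrCA.
Qed.

Lemma wedge_creater i a b : wedge a (create i b) = create i (wedge (grade a) b).
Proof.
elim/ext_ind: a => [k a a' Ha Ha'||j a Ha].
- by rewrite wedge_linearl Ha Ha' grade_linear wedge_linearl lfunL.
- by rewrite grade1 !wedge1l.
- by rewrite wedge_createl Ha grade_create wedgeNl wedge_createl create_anticomm lfunN.
Qed.

Lemma annih1 i : annih i (ext1 F n) = 0.
Proof.
apply/ffunP => U; rewrite annihE !ffunE; case: ifP => // _; rewrite (_ : _ == _ = false) ?mulr0 //.
by apply/eqP => /setP /(_ i); rewrite !inE eqxx.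
Qed.

Lemma annih_wedge i a b :
  annih i (wedge a b) = wedge (annih i a) b + wedge (grade a) (annih i b).
Proof.
elim/ext_ind: a => [k a a' Ha Ha'||j a Ha].
- rewrite wedge_linearl !lfunL Ha Ha' grade_linear !wedge_linearl.
  by rewrite scalerDr addrACA.
- by rewrite grade1 annih1 !wedge1l wedge0l add0r.
- rewrite wedge_createl annih_create Ha annih_create grade_create wedgeNl wedge_createl.
  by rewrite wedge_linearl wedgeNl wedge_createl lfunD opprD addrA.
Qed.

Lemma covectorE (v : 'rV[F]_n) : covector v = \sum_i v 0 i *: create i (ext1 F n).
Proof.
apply/ffunP => S; rewrite sum_ffunE ffunE; apply: eq_bigr => i _.
rewrite !ffunE createE ffunE; case: eqP => [->|Si].
  by rewrite set11 finset.setDv eqxx mulr1 -eps_setD1id finset.setDv /eps big_set0 [RHS]mulr1 mul1r.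
rewrite mul0r; case: ifP => iS; last by rewrite [RHS]mulr0.
rewrite (_ : _ == _ = false) ?mulr0 ?[RHS]mulr0 //.
by apply/eqP => Si0; apply: Si; rewrite -(finset.setD1K iS) Si0 finset.setU0.
Qed.

Lemma wedge_covector (v : 'rV[F]_n) b : wedge (covector v) b = \sum_i v 0 i *: create i b.
Proof.
rewrite covectorE.
elim/big_rec2: _ => [|i a a' _ <-]; first by rewrite wedge0l.
by rewrite wedge_linearl wedge_createl wedge1l.
Qed.

Lemma wedge_op_covector (v : 'rV[F]_n) :
  wedge_op (covector v) = \sum_i v 0 i *: create i.
Proof.
apply/lfunP => b; rewrite wedge_opE wedge_covector sum_lfunE.
by apply: eq_bigr => i _; rewrite scale_lfunE.
Qed.

Lemma wedge_covectorA (v : 'rV[F]_n) a b :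
  wedge (wedge (covector v) a) b = wedge (covector v) (wedge a b).
Proof.
rewrite !wedge_covector.
elim/big_rec2: _ => [|i a1 a2 _ <-]; first by rewrite wedge0l.
by rewrite wedge_linearl wedge_createl.
Qed.

End Exterior.

(** * Gram determinants *)

Section SequenceMinors.
Variables (F : fieldType) (n : nat) (Q : 'M[F]_n) (i0 : 'I_n).
Implicit Types (s t : seq 'I_n).

(** Rows and columns are listed by sequences, not sets, so that an index may be put in front out of
    order, or twice, as an expansion along an added row requires. [i0] is only the default value of
    [nth]. *)
Definition minor_seq m s t : F :=
  \det (\matrix_(a < m, b < m) Q (nth i0 s a) (nth i0 t b)).

Lemma nth_rem i s k : nth i0 (rem i s) k = nth i0 s (bump (index i s) k).
Proof.
elim: s k => [|x s IH] k; first by rewrite /= !nth_nil.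
rewrite /= eq_sym; case: eqP => [_|_]; first by rewrite /bump.
by case: k => [|k] //=; rewrite IH /bump ltnS addnS.
Qed.

Lemma minor_seq_head m i s t :
  minor_seq m.+1 (i :: s) t =
  \sum_(b < m.+1) Q i (nth i0 t b) *
    ((-1) ^+ b * \det (\matrix_(a < m, c < m) Q (nth i0 s a) (nth i0 t (bump b c)))).
Proof.
rewrite /minor_seq (expand_det_row _ ord0); apply: eq_bigr => b _.
rewrite mxE /cofactor add0n; congr (_ * (_ * \det _)).
by apply/matrixP => a c; rewrite !mxE.
Qed.

(** Both determinants are expanded along the row of [i]: the minors agree, and the sign of its
    position in [s] occurs twice on the right. *)
Lemma minor_seq_rem m i s t : i \in s -> size s = m.+1 ->
  minor_seq m.+1 (i :: rem i s) t = (-1) ^+ (index i s) * minor_seq m.+1 s t.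
Proof.
move=> iS sm; have is_lt : (index i s < m.+1)%N by rewrite -sm index_mem.
rewrite minor_seq_head /minor_seq (expand_det_row _ (Ordinal is_lt)) mulr_sumr.
apply: eq_bigr => b _; rewrite mxE /= nth_index // /cofactor [RHS]mulrCA; congr (_ * _).
rewrite exprD !mulrA -expr2 sqrr_sign mul1r.
congr (_ * \det _); apply/matrixP => a c; rewrite !mxE /=.
by rewrite nth_rem.
Qed.

Lemma minor_seq_dup m i s t : i \in s -> (size s <= m)%N ->
  minor_seq m.+1 (i :: s) t = 0.
Proof.
move=> iS sm; have is_lt : ((index i s).+1 < m.+1)%N by rewrite ltnS (leq_trans _ sm) // index_mem.
apply: (@determinant_alternate _ _ _ ord0 (Ordinal is_lt)) => // b.
by rewrite !mxE /= nth_index.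
Qed.

End SequenceMinors.

(** * The inner product on forms and the adjoints of wedge products *)

Section Gram.
Variables (F : fieldType) (n : nat) (Q : 'M[F]_n).
Implicit Types (i j k : 'I_n) (S T U : {set 'I_n}) (a b : ext F n).

Lemma ext_gram_card S T : #|S| != #|T| -> ext_gram Q S T = 0.
Proof. by rewrite /ext_gram; case: eqP. Qed.

Lemma ext_gramE i0 S T : #|S| = #|T| ->
  ext_gram Q S T = minor_seq Q i0 #|S| (enum S) (enum T).
Proof.
rewrite /ext_gram => ST; case: eqP => // e; congr (\det _); apply/matrixP => a b.
by rewrite !mxE !(enum_val_nth i0).
Qed.

Lemma enum_setD1 i S : enum (S :\ i) = rem i (enum S).
Proof.
rewrite rem_filter ?enum_uniq // /enum_mem -filter_predI.
by apply: eq_filter => j; rewrite /= !inE.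
Qed.

(** [enum S] is increasing, so the number of elements below [i] is the position of [i]. This
    identifies the sign of the exterior algebra with the sign of a cofactor. *)
Lemma eps_index i S : i \in S -> eps F i S = (-1) ^+ (index i (enum S)).
Proof.
move=> iS; rewrite /eps -big_enum.
have : sorted (fun x y : 'I_n => x < y)%N (enum S).
  apply: sorted_filter => [x y z|]; first exact: ltn_trans.
  have /= := iota_ltn_sorted 0 n; rewrite -val_enum_ord sorted_map.
  by rewrite -enumT.
have : i \in enum S by rewrite mem_enum.
elim: (enum S) => //= x s IH; rewrite inE big_cons => ixs.
rewrite path_sortedE; last by move=> ? ? ?; apply: ltn_trans.
case/andP => /allP xs ss; case: eqVneq => [xi|xi] /=.
  rewrite -xi ltnn expr0 mul1r big_seq big1 ?expr0 // => j /xs.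
  by case: ltngtP.
have is_ : i \in s by case/orP: ixs => // /eqP ix; rewrite ix eqxx in xi.
by rewrite (xs i is_) expr1 IH // exprS.
Qed.

(** The left side is the expansion, along its first row, of the determinant with rows [i :: enum S]
    and columns [enum T]. It has a repeated row if [i] is in [S]; otherwise sorting the rows costs
    the sign [eps i S]. If the cardinalities do not match, both sides vanish. *)
Lemma ext_gram_laplace i S T :
  \sum_(j in T) Q i j * (eps F j T * ext_gram Q S (T :\ j)) =
  if i \in S then 0 else eps F i S * ext_gram Q (i |: S) T.
Proof.
have [cT|cT] := eqVneq #|T| #|S|.+1; last first.
  rewrite big1 => [|j jT]; last first.
    rewrite ext_gram_card ?mulr0 //; apply: contra cT => /eqP ->.
    by rewrite (cardsD1 j T) jT.
  case: ifP => iS //; rewrite ext_gram_card ?mulr0 // cardsU1 iS add1n eq_sym.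
  by [].
have -> : \sum_(j in T) Q i j * (eps F j T * ext_gram Q S (T :\ j)) =
          minor_seq Q i #|S|.+1 (i :: enum S) (enum T).
  rewrite minor_seq_head -big_enum (big_nth i) -cardE cT big_mkord.
  apply: eq_bigr => b _.
  have jT : nth i (enum T) b \in T by rewrite -mem_enum mem_nth // -cardE cT.
  have Ib : index (nth i (enum T) b) (enum T) = b by rewrite index_uniq ?enum_uniq // -cardE cT.
  rewrite eps_index // Ib (@ext_gramE i); last first.
    by move: cT; rewrite (cardsD1 (nth i (enum T) b) T) jT => -[].
  rewrite enum_setD1 /minor_seq; congr (_ * (_ * \det _)); apply/matrixP => a c.
  by rewrite !mxE nth_rem Ib.
case: ifPn => iS.
  by rewrite minor_seq_dup ?mem_enum // -cardE.
rewrite (@ext_gramE i) ?cardsU1 ?iS // -(eps_setU1id F i S) eps_index ?setU11 //.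
rewrite -minor_seq_rem ?mem_enum ?setU11 // -?cardE ?cardsU1 ?iS //.
by rewrite -enum_setD1 finset.setU1K.
Qed.

Definition gram a b : F := \sum_S \sum_T a S * b T * ext_gram Q S T.

Lemma gram_linearr a : linear_for *%R (gram a).
Proof.
move=> k b b'; rewrite /gram mulr_sumr -big_split; apply: eq_bigr => S _ /=.
rewrite mulr_sumr -big_split; apply: eq_bigr => T _ /=.
rewrite !ffunE mulrDr mulrDl; congr (_ + _).
have mulCA (x y z w : F) : x * (y * z) * w = y * (x * z * w) by rewrite !mulrA (mulrC x).
exact: mulCA.
Qed.
HB.instance Definition _ a :=
  GRing.isLinear.Build F (ext F n) F _ (gram a) (gram_linearr a).

Lemma gram_linearl (k : F) a a' b : gram (k *: a + a') b = k * gram a b + gram a' b.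
Proof.
rewrite /gram mulr_sumr -big_split; apply: eq_bigr => S _ /=.
rewrite mulr_sumr -big_split; apply: eq_bigr => T _ /=.
rewrite !ffunE !mulrDl; congr (_ + _).
by rewrite -!mulrA.
Qed.

Lemma create_annih_dual i a b :
  \sum_S create F i a S * b S = \sum_S a S * annih F i b S.
Proof.
rewrite (bigID (fun S : {set 'I_n} => i \in S)) /= [X in _ + X]big1 ?addr0; last first.
  by move=> S /negPf iS; rewrite createE iS mul0r.
rewrite (reindex_onto (fun S : {set 'I_n} => i |: S) (fun S => S :\ i)) /=; last first.
  by move=> S; apply: finset.setD1K.
rewrite [RHS](bigID (fun S : {set 'I_n} => i \notin S)) /= [X in _ + X]big1 ?addr0; last first.
  by move=> S; rewrite negbK annihE => ->; rewrite mulr0.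
apply: eq_big => [S|S /andP[_ /eqP SE]].
  rewrite setU11 /=; apply/eqP/idP => [<-|]; last exact: finset.setU1K.
  by rewrite !inE eqxx.
have iS : i \notin S by rewrite -SE !inE eqxx.
rewrite createE setU11 finset.setU1K // annihE (negPf iS) eps_setU1id -mulrA.
exact: mulrCA.
Qed.

(** [ext_gram_laplace] read as an adjunction. In coordinates [create] is the transpose of [annih],
    so it can be moved onto the Gram matrix; the expansion then moves it on to [b], where it becomes
    the metric contraction. *)
Lemma gram_create i a b :
  gram (create F i a) b = gram a (\sum_j Q i j *: annih F j b).
Proof.
have gramE a' b' : gram a' b' = \sum_S a' S * [ffun U : {set 'I_n} => \sum_T b' T * ext_gram Q U T : F^o] S.
  apply: eq_bigr => S _; rewrite ffunE mulr_sumr.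
  by apply: eq_bigr => T _; rewrite mulrA.
rewrite !gramE create_annih_dual; apply: eq_bigr => S _; congr (_ * _).
rewrite annihE !ffunE.
transitivity (\sum_(T : {set 'I_n}) b T * \sum_(j in T) Q i j * (eps F j T * ext_gram Q S (T :\ j))).
  under [RHS]eq_bigr do rewrite ext_gram_laplace.
  case: ifP => _; first by rewrite big1 // => T _; rewrite mulr0.
  by rewrite mulr_sumr; apply: eq_bigr => T _; rewrite mulrCA.
under eq_bigr do rewrite mulr_sumr.
under [RHS]eq_bigr do rewrite sum_ffunE mulr_suml.
rewrite [RHS]exchange_big /= (exchange_big_dep predT) //=; apply: eq_bigr => j _.
transitivity (Q i j * \sum_T [ffun U => ext_gram Q S U : F^o] T * annih F j b T); last first.
  rewrite mulr_sumr; apply: eq_bigr => T _; rewrite !ffunE.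
  by rewrite -!mulrA; congr (_ * _); apply: mulrC.
rewrite -create_annih_dual mulr_sumr big_mkcond; apply: eq_bigr => T _.
rewrite createE ffunE; case: ifP => _; last by rewrite mul0r mulr0.
by rewrite mulrCA; congr (_ * _); rewrite mulrC.
Qed.

Lemma gram1 b : gram (ext1 F n) b = b finset.set0.
Proof.
rewrite /gram (bigD1 finset.set0) //= [X in _ + X]big1 ?addr0; last first.
  by move=> S /negPf S0; rewrite big1 // => T _; rewrite ffunE S0 !mul0r.
rewrite (bigD1 finset.set0) //= big1 ?addr0; last first.
  move=> T T0; rewrite ext_gram_card ?mulr0 // cards0 eq_sym cards_eq0.
  by [].
rewrite ffunE eqxx mul1r /ext_gram; case: eqP => // e.
rewrite (_ : \det _ = 1) ?mulr1 //.
have det0 m (A : 'M[F]_m) : m = 0%N -> \det A = 1 by move=> m0; subst m; rewrite det_mx00.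
by apply: det0; rewrite cards0.
Qed.

(** As [Q] is invertible, each [annih j] is a combination of adjoints of the [create i], hence
    preserves the radical. An element of the radical has zero constant term, by pairing with 1;
    contracting its other coefficients down to the constant term shows that they vanish too. *)
Lemma gram_nondeg b : Q \in unitmx -> (forall a, gram a b = 0) -> b = 0.
Proof.
move=> Qu; move=> b0.
have stable j c : (forall a, gram a c = 0) -> forall a, gram a (annih F j c) = 0.
  move=> c0 a.
  have -> : annih F j c = \sum_i invmx Q j i *: \sum_k Q i k *: annih F k c.
    under eq_bigr do rewrite scaler_sumr.
    rewrite exchange_big /= (bigD1 j) //= [X in _ + X]big1 ?addr0 => [|k kj].
      under eq_bigr do rewrite scalerA.
      rewrite -scaler_suml (_ : \sum_i _ = 1) ?scale1r //.
      by have /matrixP/(_ j j) := mulVmx Qu; rewrite !mxE eqxx.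
    under eq_bigr do rewrite scalerA.
    rewrite -scaler_suml (_ : \sum_i _ = 0) ?scale0r //.
    by have /matrixP/(_ j k) := mulVmx Qu; rewrite !mxE eq_sym (negPf kj).
  rewrite linear_sum big1 // => i _; rewrite linearZ /= -gram_create c0.
  exact: mulr0.
have b00 S c : (forall a, gram a c = 0) -> c S = 0.
  elim: {S}_.+1 {-2}S (ltnSn #|S|) c => // m IH S Sm c c0.
  have [->|[i iS]] := set_0Vmem S; first by rewrite -gram1.
  have := IH (S :\ i) _ (annih F i c) (stable _ _ c0).
  rewrite (cardsD1 i) iS in Sm.
  move=> /(_ Sm); rewrite annihE !inE eqxx /= finset.setD1K // => /(congr1 (fun x => eps F i (S :\ i) * x)).
  by rewrite epsK mulr0.
by apply/ffunP => S; rewrite b00 // ffunE.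
Qed.

End Gram.

(** * Canonical anticommutation relations for arbitrary covectors *)

Section CanonicalAnticommutation.
Variables (F : fieldType) (n : nat) (Q : 'M[F]_n).
Implicit Types (u v : 'rV[F]_n).

(** Contraction with the metric dual of [v]: as [Q] is the Gram matrix of covectors, [v *m Q] lists
    the coordinates of the dual vector. *)
Definition contract v : 'End(ext F n) := \sum_i (v *m Q) 0 i *: annih F i.

Lemma mul_combs (V : vectType F) (x y : 'I_n -> F) (f g : 'I_n -> 'End(V)) :
  (\sum_i x i *: f i) * (\sum_j y j *: g j) = \sum_i \sum_j (x i * y j) *: (f i * g j).
Proof.
rewrite mulr_suml; apply: eq_bigr => i _; rewrite mulr_sumr; apply: eq_bigr => j _.
by rewrite scale_lfunAl scale_lfunAr scalerA.
Qed.

Lemma anticomm_combs (V : vectType F) (x y : 'I_n -> F) (f : 'I_n -> 'End(V)) :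
  (forall i j, f i * f j = - (f j * f i)) ->
  (\sum_i x i *: f i) * (\sum_j y j *: f j) = - ((\sum_j y j *: f j) * (\sum_i x i *: f i)).
Proof.
move=> ff; rewrite !mul_combs exchange_big -sumrN; apply: eq_bigr => i _ /=.
by rewrite -sumrN; apply: eq_bigr => j _; rewrite ff scalerN mulrC.
Qed.

Lemma wedge_op_anticomm u v :
  wedge_op (covector u) * wedge_op (covector v) = - (wedge_op (covector v) * wedge_op (covector u)).
Proof.
rewrite !wedge_op_covector; apply: anticomm_combs => i j.
by apply/lfunP => a; rewrite opp_lfunE !mul_lfunE create_anticomm.
Qed.

Lemma contract_anticomm u v : contract u * contract v = - (contract v * contract u).
Proof.
apply: anticomm_combs => i j.
by apply/lfunP => a; rewrite opp_lfunE !mul_lfunE annih_anticomm.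
Qed.

Lemma contract_wedge_op u v :
  contract u * wedge_op (covector v) + wedge_op (covector v) * contract u
  = (u *m Q *m v^T) 0 0 *: (1 : 'End(ext F n)).
Proof.
rewrite wedge_op_covector !mul_combs [X in _ + X]exchange_big -big_split /=.
rewrite [in RHS]mxE scaler_suml; apply: eq_bigr => i _.
rewrite -big_split (bigD1 i) //= big1 ?addr0 => [|j ji].
  rewrite [v 0 i * _]mulrC -scalerDr [(v^T) i 0]mxE; congr (_ *: _); apply/lfunP => a.
  by rewrite add_lfunE !mul_lfunE annih_create eqxx scale1r subrK one_lfunE.
rewrite [v 0 j * _]mulrC -scalerDr (_ : _ + _ = 0) ?scaler0 //; apply/lfunP => a.
by rewrite add_lfunE !mul_lfunE annih_create eq_sym (negPf ji) scale0r sub0r addNr zero_lfunE.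
Qed.

Lemma contract1 v : contract v (ext1 F n) = 0.
Proof. by rewrite sum_lfunE big1 // => i _; rewrite scale_lfunE annih1 scaler0. Qed.

End CanonicalAnticommutation.

(** * Complexification *)

Section Complexification.
Variables (R : realType) (n : nat).
Implicit Types (f g : 'End(ext R n)) (a b : ext R[i] n).

Lemma ext_complexP a b : ext_Re a = ext_Re b -> ext_Im a = ext_Im b -> a = b.
Proof.
move=> /ffunP re /ffunP im; apply/ffunP => S.
by move: (re S) (im S); rewrite !ffunE; case: (a S) (b S) => [? ?] [? ?] /= -> ->.
Qed.

Lemma ext_ReL (k : R[i]) a b :
  ext_Re (k *: a + b) = complex.Re k *: ext_Re a + (- complex.Im k *: ext_Im a + ext_Re b).
Proof.
apply/ffunP => S; rewrite !ffunE; case: k => kr ki; case: (a S) (b S) => [? ?] [? ?] /=.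
by rewrite addrA scaleNr.
Qed.

Lemma ext_ImL (k : R[i]) a b :
  ext_Im (k *: a + b) = complex.Re k *: ext_Im a + (complex.Im k *: ext_Re a + ext_Im b).
Proof.
apply/ffunP => S; rewrite !ffunE; case: k => kr ki; case: (a S) (b S) => [? ?] [? ?] /=.
by rewrite addrA.
Qed.

Lemma ext_Re_real (x y : ext R n) : ext_Re (ext_of_real x + imag R *: ext_of_real y) = x.
Proof.
apply/ffunP => S; rewrite !ffunE /=.
by rewrite !(mul0r, mul1r, mulr0, subr0, addr0).
Qed.

Lemma ext_Im_real (x y : ext R n) : ext_Im (ext_of_real x + imag R *: ext_of_real y) = y.
Proof.
apply/ffunP => S; rewrite !ffunE /=.
by rewrite !(mul0r, mul1r, mulr0, add0r, addr0).
Qed.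

Definition complexify_fun f a : ext R[i] n :=
  ext_of_real (f (ext_Re a)) + imag R *: ext_of_real (f (ext_Im a)).

Lemma ext_Re_complexify_fun f a : ext_Re (complexify_fun f a) = f (ext_Re a).
Proof. exact: ext_Re_real. Qed.

Lemma ext_Im_complexify_fun f a : ext_Im (complexify_fun f a) = f (ext_Im a).
Proof. exact: ext_Im_real. Qed.

Lemma complexify_fun_linear f : linear (complexify_fun f).
Proof.
move=> k a b.
move: (ext_Re_complexify_fun f (k *: a + b)) (ext_Im_complexify_fun f (k *: a + b)).
move: (ext_Re_complexify_fun f a) (ext_Im_complexify_fun f a).
move: (ext_Re_complexify_fun f b) (ext_Im_complexify_fun f b).
move: (complexify_fun f (k *: a + b)) (complexify_fun f a) (complexify_fun f b) => c' a' b'.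
move=> rb ib ra ia rc ic; apply: ext_complexP.
  by rewrite (ext_ReL k a' b') ra ia rb rc (ext_ReL k a b) (lfunL f) (lfunL f).
by rewrite (ext_ImL k a' b') ra ia ib ic (ext_ImL k a b) (lfunL f) (lfunL f).
Qed.
HB.instance Definition _ f :=
  GRing.isLinear.Build R[i] (ext R[i] n) (ext R[i] n) _ (complexify_fun f)
    (complexify_fun_linear f).

Lemma complexifyE f a : complexify f a = complexify_fun f a.
Proof. exact: (lfunE (complexify_fun f)). Qed.

Lemma ext_Re_complexify f a : ext_Re (complexify f a) = f (ext_Re a).
Proof. by rewrite complexifyE; exact: ext_Re_real. Qed.

Lemma ext_Im_complexify f a : ext_Im (complexify f a) = f (ext_Im a).
Proof. by rewrite complexifyE; exact: ext_Im_real. Qed.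

Lemma ext_ReD a b : ext_Re (a + b) = ext_Re a + ext_Re b.
Proof. by have := ext_ReL 1 a b; rewrite scale1r /= oppr0 scale0r add0r scale1r. Qed.

Lemma ext_ImD a b : ext_Im (a + b) = ext_Im a + ext_Im b.
Proof. by have := ext_ImL 1 a b; rewrite scale1r /= scale0r add0r scale1r. Qed.

Lemma ext_ReZ (r : R) a : ext_Re (r%:C%C *: a) = r *: ext_Re a.
Proof.
by apply/ffunP => S; rewrite !ffunE; case: (a S) => [? ?] /=; rewrite mul0r subr0.
Qed.

Lemma ext_ImZ (r : R) a : ext_Im (r%:C%C *: a) = r *: ext_Im a.
Proof.
by apply/ffunP => S; rewrite !ffunE; case: (a S) => [? ?] /=; rewrite mul0r addr0.
Qed.

Lemma complexify_ext f (h : 'End(ext R[i] n)) :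
  (forall a, ext_Re (h a) = f (ext_Re a)) -> (forall a, ext_Im (h a) = f (ext_Im a)) ->
  complexify f = h.
Proof.
move=> re im; apply/lfunP => a; apply: ext_complexP.
  exact: etrans (ext_Re_complexify f a) (esym (re a)).
exact: etrans (ext_Im_complexify f a) (esym (im a)).
Qed.

Lemma complexifyM f g : complexify (f * g) = complexify f * complexify g.
Proof.
apply: complexify_ext => a; rewrite !mul_lfunE.
  exact: etrans (ext_Re_complexify f _) (congr1 f (ext_Re_complexify g a)).
exact: etrans (ext_Im_complexify f _) (congr1 f (ext_Im_complexify g a)).
Qed.

Lemma complexifyD f g : complexify (f + g) = complexify f + complexify g.
Proof.
apply: complexify_ext => a; rewrite !add_lfunE.
  exact: etrans (ext_ReD _ _) (congr2 +%R (ext_Re_complexify f a) (ext_Re_complexify g a)).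
exact: etrans (ext_ImD _ _) (congr2 +%R (ext_Im_complexify f a) (ext_Im_complexify g a)).
Qed.

Lemma complexifyZ (r : R) f : complexify (r *: f) = r%:C%C *: complexify f.
Proof.
apply: complexify_ext => a; rewrite !scale_lfunE.
  exact: etrans (ext_ReZ r _) (congr1 ( *:%R r) (ext_Re_complexify f a)).
exact: etrans (ext_ImZ r _) (congr1 ( *:%R r) (ext_Im_complexify f a)).
Qed.

Lemma complexifyN f : complexify (- f) = - complexify f.
Proof. by rewrite -scaleN1r complexifyZ rmorphN1 scaleN1r. Qed.

Lemma complexifyB f g : complexify (f - g) = complexify f - complexify g.
Proof. by rewrite complexifyD complexifyN. Qed.

Lemma complexify0 : complexify (0 : 'End(ext R n)) = 0.
Proof. by rewrite -(scale0r 0) complexifyZ scale0r. Qed.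

Lemma complexify1 : complexify (1 : 'End(ext R n)) = 1.
Proof. by apply: complexify_ext => a; rewrite !one_lfunE. Qed.

Lemma complexify_sum (I : Type) (r : seq I) (P : pred I) (h : I -> 'End(ext R n)) :
  complexify (\sum_(i <- r | P i) h i) = \sum_(i <- r | P i) complexify (h i).
Proof. exact: (big_morph _ complexifyD complexify0). Qed.

Lemma complexify_bracket f g :
  complexify (op_bracket f g) = op_bracket (complexify f) (complexify g).
Proof.
exact: etrans (complexifyB _ _) (congr2 (fun x y => x - y) (complexifyM f g) (complexifyM g f)).
Qed.

Lemma ext_Re_of_real (x : ext R n) : ext_Re (ext_of_real x) = x.
Proof. by apply/ffunP => S; rewrite !ffunE. Qed.

Lemma ext_Im_of_real (x : ext R n) : ext_Im (ext_of_real x) = 0.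
Proof. by apply/ffunP => S; rewrite !ffunE. Qed.

Lemma complexify_of_real f x : complexify f (ext_of_real x) = ext_of_real (f x).
Proof.
apply: ext_complexP.
  apply: etrans (ext_Re_complexify f _) _.
  exact: etrans (congr1 f (ext_Re_of_real x)) (esym (ext_Re_of_real _)).
apply: etrans (ext_Im_complexify f _) _.
exact: etrans (etrans (congr1 f (ext_Im_of_real x)) (lfun0 f)) (esym (ext_Im_of_real _)).
Qed.

Lemma complexify_inj : injective (@complexify R n).
Proof.
move=> f g fg; apply/lfunP => x.
have := ext_Re_complexify g (ext_of_real x).
rewrite -fg => gE; have := etrans (esym (ext_Re_complexify f _)) gE.
by rewrite (ext_Re_of_real x).
Qed.

Lemma ext_conj_complexify f a : ext_conj (complexify f a) = complexify f (ext_conj a).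
Proof.
have Rec b : ext_Re (ext_conj b) = ext_Re b.
  by apply/ffunP => S; rewrite !ffunE; case: (b S).
have Imc b : ext_Im (ext_conj b) = - ext_Im b.
  by apply/ffunP => S; rewrite !ffunE; case: (b S).
apply: ext_complexP.
  apply: etrans (etrans (Rec _) (ext_Re_complexify f a)) _.
  exact: esym (etrans (ext_Re_complexify f _) (congr1 f (Rec a))).
apply: etrans (etrans (Imc _) (congr1 -%R (ext_Im_complexify f a))) _.
apply: esym (etrans (ext_Im_complexify f _) (etrans (congr1 f (Imc a)) _)).
exact: lfunN.
Qed.

Lemma complexify_create i : complexify (create R i) = create R[i] i :> 'End(ext R[i] n).
Proof.
have epsC S : eps R[i] i S = (eps R i S)%:C%C.
  by rewrite rmorph_prod; apply: eq_bigr => k _; rewrite rmorphXn rmorphN1.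
apply: complexify_ext => a; apply/ffunP => S; rewrite ffunE !createE ffunE; case: ifP => // _.
  by rewrite epsC; case: (a _) => x y /=; rewrite mul0r subr0.
by rewrite epsC; case: (a _) => x y /=; rewrite mul0r addr0.
Qed.

Lemma complexify_annih i : complexify (annih R i) = annih R[i] i :> 'End(ext R[i] n).
Proof.
have epsC S : eps R[i] i S = (eps R i S)%:C%C.
  by rewrite rmorph_prod; apply: eq_bigr => k _; rewrite rmorphXn rmorphN1.
apply: complexify_ext => a; apply/ffunP => S; rewrite ffunE !annihE ffunE; case: ifP => // _.
  by rewrite epsC; case: (a _) => x y /=; rewrite mul0r subr0.
by rewrite epsC; case: (a _) => x y /=; rewrite mul0r addr0.
Qed.

Variable (Q : 'M[R]_n).

Lemma hermE a b : herm Q a b =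
  (gram Q (ext_Re a) (ext_Re b) + gram Q (ext_Im a) (ext_Im b))%:C%C
  + imag R * (gram Q (ext_Im a) (ext_Re b) - gram Q (ext_Re a) (ext_Im b))%:C%C.
Proof.
rewrite /herm /gram -sumrB -big_split /= !rmorph_sum mulr_sumr -big_split /=.
apply: eq_bigr => S _.
rewrite -sumrB -big_split /= !rmorph_sum mulr_sumr -big_split /=; apply: eq_bigr => T _.
rewrite !ffunE; case: (a S) (b T) => [a1 a2] [b1 b2].
apply/eqP; rewrite eq_complex /=; apply/andP; split; apply/eqP; ring.
Qed.

Lemma herm_ReIm a b x x' y y' :
  ext_Re a = x -> ext_Im a = x' -> ext_Re b = y -> ext_Im b = y' ->
  herm Q a b = (gram Q x y + gram Q x' y')%:C%C + imag R * (gram Q x' y - gram Q x y')%:C%C.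
Proof. by move=> <- <- <- <-; exact: hermE. Qed.

Definition adjoint_wrt f g := forall x y, gram Q (f x) y = gram Q x (g y).

(** A complexified operator acts separately on real and imaginary parts, and on real forms [herm] is
    [gram]; Hermitian adjoints of generators are therefore real transposes. *)
Lemma herm_adjoint_complexify f g :
  herm_adjoint Q (complexify f) (complexify g) <-> adjoint_wrt f g.
Proof.
have herm_real x y : herm Q (ext_of_real x) (ext_of_real y) = (gram Q x y)%:C%C.
  rewrite /herm /gram !rmorph_sum; apply: eq_bigr => S _.
  rewrite !rmorph_sum; apply: eq_bigr => T _.
  rewrite !ffunE !rmorphM; congr (_ * _ * _).
  by rewrite /conjc /= oppr0.
split=> [fg x y|fg a b]; last first.
  apply: etrans (herm_ReIm (ext_Re_complexify f a) (ext_Im_complexify f a) erefl erefl) _.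
  apply: esym; apply: etrans (herm_ReIm erefl erefl (ext_Re_complexify g b) (ext_Im_complexify g b)) _.
  by move: (ext_Re a) (ext_Im a) (ext_Re b) (ext_Im b) => x x' y y'; rewrite !fg.
have fgxy := etrans (esym (congr1 (fun z => herm Q z (ext_of_real y)) (complexify_of_real f x)))
  (etrans (fg _ _) (congr1 (herm Q (ext_of_real x)) (complexify_of_real g y))).
have := etrans (esym (herm_real _ _)) (etrans fgxy (herm_real _ _)).
by move=> [].
Qed.

Lemma adjointM f f' g g' : adjoint_wrt f f' -> adjoint_wrt g g' -> adjoint_wrt (f * g) (g' * f').
Proof. by move=> ff gg x y; rewrite !mul_lfunE ff gg. Qed.

Lemma adjointL (r : R) f f' g g' : adjoint_wrt f f' -> adjoint_wrt g g' ->
  adjoint_wrt (r *: f + g) (r *: f' + g').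
Proof.
move=> ff gg x y; rewrite !add_lfunE !scale_lfunE gram_linearl ff gg.
by rewrite linearP.
Qed.

Lemma adjoint_unique f g g' : Q \in unitmx -> adjoint_wrt f g -> adjoint_wrt f g' -> g = g'.
Proof.
move=> Qu fg fg'; apply/lfunP => y; apply/eqP; rewrite -subr_eq0; apply/eqP.
apply: (gram_nondeg Qu) => x.
by rewrite linearB /= -fg -fg' subrr.
Qed.

Lemma adjoint_covector (v : 'rV[R]_n) : adjoint_wrt (wedge_op (covector v)) (contract Q v).
Proof.
have -> : contract Q v = \sum_i v 0 i *: \sum_j Q i j *: annih R j.
  under [RHS]eq_bigr do rewrite scaler_sumr.
  rewrite exchange_big; apply: eq_bigr => j _ /=; rewrite mxE scaler_suml.
  by apply: eq_bigr => i _; rewrite scalerA.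
rewrite wedge_op_covector.
elim/big_rec2: _ => [x y|i f f' _ ff].
  by rewrite !zero_lfunE [RHS]linear0 -(scale0r 0) -[_ *: 0]addr0 gram_linearl mul0r add0r;
    rewrite -(scale0r 0) /gram big1 // => S _; rewrite big1 // => T _; rewrite scale0r ffunE !mul0r.
apply: adjointL => // x y; rewrite gram_create; congr gram.
by rewrite sum_lfunE; apply: eq_bigr => j _; rewrite scale_lfunE.
Qed.

End Complexification.

(** * The pairing *)

Section TopCoefficient.
Variables (F : fieldType) (n : nat).
Implicit Types (i j : 'I_n) (S T U : {set 'I_n}) (a b : ext F n) (P : 'End(ext F n)).

Definition top a : F := a [set: 'I_n]%SET.

Lemma topL (k : F) a b : top (k *: a + b) = k * top a + top b.
Proof. by rewrite /top !ffunE. Qed.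

Lemma topD a b : top (a + b) = top a + top b.
Proof. by rewrite /top !ffunE. Qed.

Lemma topN a : top (- a) = - top a.
Proof. by rewrite /top !ffunE. Qed.

Lemma top_annih i a : top (annih F i a) = 0.
Proof. by rewrite /top annihE finset.in_setT. Qed.

(** The complementary monomial isolates a single coefficient of [a]; nondegeneracy of the pairing
    rests on this. *)
Lemma top_wedge_mono S a : top (wedge a (mono F (~: S)%SET)) = wedge_sign F S (~: S) * a S.
Proof.
rewrite /top ffunE (bigD1 S) ?finset.subsetT //= big1 ?addr0 => [|U /andP[_ US]].
  by rewrite ffunE finset.setTD eqxx mulr1.
rewrite ffunE finset.setTD (inj_eq (can_inj (@finset.setCK _))) (negPf US) mulr0.
by [].
Qed.

Lemma wedge_sign_neq0 S T : wedge_sign F S T != 0.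
Proof. by rewrite /wedge_sign signr_eq0. Qed.

Variable w : nat -> F.

Definition weight a : ext F n := [ffun S : {set 'I_n} => w #|S| * a S].

Lemma weight_linear : linear weight.
Proof. by move=> k a b; apply/ffunP => S; rewrite !ffunE mulrDr; congr (_ + _); exact: mulrCA. Qed.
HB.instance Definition _ :=
  GRing.isLinear.Build F (ext F n) (ext F n) _ weight weight_linear.

(* [weight] absorbs the powers of the imaginary unit in the pairing, so that
   these two conditions make [P] infinitesimally preserve it. *)
Definition skew_top P :=
  (forall a b, top (wedge (P a) b) = top (wedge a (P b))) /\
  (forall b, weight (P b) = - P (weight b)).

Lemma skew_topL (k : F) P P' : skew_top P -> skew_top P' -> skew_top (k *: P + P').
Proof.
move=> [P1 P2] [P1' P2']; split=> [a b|b]; rewrite !add_lfunE !scale_lfunE.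
  by rewrite wedge_linearl linearP !topL P1 P1'.
by rewrite linearP /= P2 P2' scalerN opprD.
Qed.

Lemma skew_top0 : skew_top 0.
Proof.
split=> [a b|b]; rewrite !zero_lfunE; first by rewrite wedge0l linear0 /top ffunE.
by rewrite linear0 oppr0.
Qed.

Lemma skew_topZ (k : F) P : skew_top P -> skew_top (k *: P).
Proof. by move=> sP; rewrite -[_ *: _]addr0; exact: skew_topL skew_top0. Qed.

Lemma skew_top_sum (I : Type) (r : seq I) (h : I -> 'End(ext F n)) :
  (forall x, skew_top (h x)) -> skew_top (\sum_(x <- r) h x).
Proof.
move=> sh; elim/big_rec: _ => [|x P _ sP]; first exact: skew_top0.
by rewrite -[h x]scale1r; exact: skew_topL.
Qed.

Hypothesis wSS : forall l, (l.+2 <= n)%N -> w l.+2 = - w l.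

(** Each [create] passes the left factor at the price of [grade], and two passages cancel. The
    degree rises by two, so [wSS] supplies the sign. *)
Lemma skew_top_create i j : skew_top (create F i * create F j).
Proof.
split=> [a b|b]; first by rewrite !mul_lfunE !wedge_createl !wedge_creater gradeK.
apply/ffunP => S; rewrite !ffunE !mul_lfunE !createE ffunE.
case: ifP => iS; last by rewrite mulr0 oppr0.
case: ifP => jS; last by rewrite !mulr0 oppr0.
have cS : #|S| = #|S :\ i :\ j|.+2 by rewrite (cardsD1 i) iS (cardsD1 j) jS.
rewrite cS wSS; last by rewrite -cS -[X in (_ <= X)%N]card_ord max_card.
by rewrite mulNr mulrCA [w _ * (eps _ j _ * _)]mulrCA.
Qed.

(** A contraction has no component of top degree, so the antiderivation rule is an integration by
    parts. Done twice, it leaves one minus sign and reverses the two contractions; anticommutation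
    undoes both. *)
Lemma skew_top_annih i j : skew_top (annih F i * annih F j).
Proof.
split=> [a b|b]; rewrite ?mul_lfunE.
  have := top_annih i (wedge (annih F j a) b).
  rewrite annih_wedge grade_annih wedgeNl topD topN => /eqP; rewrite subr_eq0 => /eqP ->.
  have := top_annih j (wedge (grade a) (annih F i b)).
  rewrite annih_wedge gradeK topD => /eqP; rewrite addr_eq0 => /eqP ->.
  by rewrite -topN -linearN -annih_anticomm.
apply/ffunP => S; rewrite !ffunE !annihE ffunE.
case: ifPn => iS; first by rewrite mulr0 oppr0.
case: ifPn => jS; first by rewrite !mulr0 oppr0.
have cS : #|j |: (i |: S)| = #|S|.+2 by rewrite !cardsU1 iS jS.
rewrite cS wSS; last by rewrite -cS -[X in (_ <= X)%N]card_ord max_card.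
rewrite mulNr !mulrN opprK mulrCA.
by rewrite [w _ * (eps _ j _ * _)]mulrCA.
Qed.

Lemma skew_top_comb2 (P : 'I_n -> 'End(ext F n)) (u v : 'I_n -> F) :
  (forall i j, skew_top (P i * P j)) ->
  skew_top ((\sum_i u i *: P i) * (\sum_j v j *: P j)).
Proof.
move=> sP; rewrite mulr_suml; apply: skew_top_sum => i.
rewrite mulr_sumr; apply: skew_top_sum => j.
by rewrite scale_lfunAl scale_lfunAr; do 2!apply: skew_topZ.
Qed.

Lemma homogeneous_sum a : a = \sum_(k < n.+1) homogeneous_part k a.
Proof.
apply/ffunP => S; rewrite sum_ffunE.
have cS : (#|S| < n.+1)%N by rewrite ltnS -[X in (_ <= X)%N]card_ord max_card.
rewrite (bigD1 (Ordinal cS)) //= big1 ?addr0 => [|k kS]; rewrite ffunE ?eqxx //.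
by rewrite eq_sym -[#|S|]/(val (Ordinal cS)) val_eqE (negPf kS).
Qed.

Lemma weight_homogeneous l a : weight (homogeneous_part l a) = w l *: homogeneous_part l a.
Proof.
apply/ffunP => S; rewrite !ffunE; case: eqP => [->|_] //.
by rewrite mulr0 [RHS]mulr0.
Qed.

Lemma top_wedge_homogeneous k l a b : (k + l)%N != n ->
  top (wedge (homogeneous_part k a) (homogeneous_part l b)) = 0.
Proof.
move=> kl; rewrite /top ffunE big1 // => S _; rewrite !ffunE finset.setTD.
case: eqP => [Sk|_]; last by rewrite mulr0 mul0r.
case: eqP => [Sl|_]; last by rewrite mulr0.
by case/eqP: kl; rewrite -Sk -Sl cardsC card_ord.
Qed.

Lemma top_wedge_weight a b :
  \sum_(l < n.+1) \sum_(k < n.+1)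
     w l * top (wedge (homogeneous_part k a) (homogeneous_part l b))
  = top (wedge a (weight b)).
Proof.
rewrite {2}(homogeneous_sum b) linear_sum linear_sum /=.
have top_sum (G : 'I_n.+1 -> ext F n) : top (\sum_l G l) = \sum_l top (G l).
  by rewrite /top sum_ffunE.
rewrite top_sum; apply: eq_bigr => l _; rewrite weight_homogeneous linearZ /=.
rewrite -mulr_sumr [RHS]ffunE; congr (w l * _).
rewrite -top_sum {2}(homogeneous_sum a); congr top.
elim/big_rec2: _ => [|k x y _ ->]; first by rewrite wedge0l.
by rewrite -[homogeneous_part k a]scale1r wedge_linearl !scale1r.
Qed.

End TopCoefficient.

(** * The volume form of an orthonormal coframe *)

Section Volume.
Variables (F : fieldType) (n m : nat) (Q : 'M[F]_n) (v : 'I_2 -> 'I_m -> 'rV[F]_n).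
Hypothesis orth : forall i j i' j',
  (v i j *m Q *m (v i' j')^T) 0 0 = ((i == i') && (j == j'))%:R.
Implicit Types (S : {set 'I_n}) (a b : ext F n) (r : seq 'I_m).

Definition partial_volume r : ext F n :=
  \big[@wedge F n / ext1 F n]_(j <- r) wedge (covector (v ord0 j)) (covector (v ord_max j)).

Lemma partial_volume_cons j r : partial_volume (j :: r) =
  wedge_op (covector (v ord0 j)) (wedge_op (covector (v ord_max j)) (partial_volume r)).
Proof. by rewrite /partial_volume big_cons wedge_covectorA !wedge_opE. Qed.

Definition concentrated k a := forall S, #|S| != k -> a S = 0.

Lemma concentrated_covector k (u : 'rV[F]_n) a :
  concentrated k a -> concentrated k.+1 (wedge_op (covector u) a).
Proof.
move=> ca S Sk; rewrite wedge_opE wedge_covector sum_ffunE big1 // => i _.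
rewrite ffunE createE; case: ifP => iS; last exact: mulr0.
by rewrite ca ?mulr0 ?[LHS]mulr0 //; apply: contra Sk; rewrite (cardsD1 i S) iS.
Qed.

Lemma concentrated_volume r : concentrated (size r).*2 (partial_volume r).
Proof.
elim: r => [|j r IH].
  by move=> S; rewrite /partial_volume big_nil ffunE cards_eq0 => /negPf ->.
by rewrite partial_volume_cons doubleS; do 2!apply: concentrated_covector.
Qed.

Lemma contract_covector i j i' j' a :
  contract Q (v i j) (wedge_op (covector (v i' j')) a) =
  ((i == i') && (j == j'))%:R *: a - wedge_op (covector (v i' j')) (contract Q (v i j) a).
Proof.
rewrite -orth; have /lfunP/(_ a) := contract_wedge_op Q (v i j) (v i' j').
by rewrite add_lfunE scale_lfunE !mul_lfunE one_lfunE => <-; rewrite addrK.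
Qed.

Lemma contract_volume i j r : j \notin r -> contract Q (v i j) (partial_volume r) = 0.
Proof.
elim: r => [|k r IH]; first by rewrite /partial_volume big_nil contract1.
rewrite inE negb_or => /andP[/negPf jk jr].
by rewrite partial_volume_cons !contract_covector jk !andbF IH // !lfun0 !(scale0r, subr0, lfun0).
Qed.

(** Contracting with [v ord0 j] and then with [v ord_max j] strips the pair [j] from the product, so
    a vanishing product would force the shorter one to vanish, down to the empty product 1. *)
Lemma partial_volume_neq0 r : uniq r -> partial_volume r != 0.
Proof.
elim: r => [|j r IH] /= => [_|/andP[jr ur]].
  apply/eqP => /ffunP/(_ finset.set0)/eqP; rewrite /partial_volume big_nil !ffunE eqxx.
  by rewrite oner_eq0.
apply: contra (IH ur) => /eqP vol0.
set w := partial_volume r in vol0 *.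
have cw i : contract Q (v i j) w = 0 by exact: contract_volume.
have c0 : contract Q (v ord0 j) (partial_volume (j :: r)) = wedge_op (covector (v ord_max j)) w.
  rewrite partial_volume_cons -/w contract_covector !eqxx scale1r.
  by rewrite contract_covector cw lfun0 /= scale0r subr0 lfun0 subr0.
have := contract_covector ord_max j ord_max j w.
by rewrite -c0 vol0 !lfun0 cw lfun0 !eqxx scale1r subr0 => <-.
Qed.

(** The volume form lives in top degree only, so pairing with it sees just the top coefficient. The
    factor [k] cannot be 0, since the volume form would then lie in the radical of [gram]. *)
Lemma gram_volume r : Q \in unitmx -> uniq r -> (size r).*2 = n ->
  exists2 k : F, k != 0 & forall a, gram Q a (partial_volume r) = top a * k.
Proof.
move=> Qu ur rn; set w := partial_volume r.
have gramE a : gram Q a w = top a * (w [set: 'I_n]%SET * ext_gram Q [set: 'I_n]%SET [set: 'I_n]%SET).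
  have card_full S : S != [set: 'I_n]%SET -> #|S| != n.
    by apply: contra => /eqP Sn; rewrite eqEcard finset.subsetT cardsT card_ord Sn /=.
  have wS S : S != [set: 'I_n]%SET -> w S = 0.
    by move/card_full; rewrite -[X in _ != X]rn; exact: concentrated_volume.
  rewrite /gram (bigD1 [set: 'I_n]%SET) //= [X in _ + X]big1 ?addr0; last first.
    move=> S Sf; rewrite big1 // => T _.
    have [->|Tf] := eqVneq T [set: 'I_n]%SET; last by rewrite wS ?mulr0 ?mul0r.
    by rewrite ext_gram_card ?mulr0 // cardsT card_ord card_full.
  rewrite (bigD1 [set: 'I_n]%SET) //= big1 ?addr0 ?mulrA // => T Tf.
  by rewrite wS ?mulr0 ?mul0r.
exists (w [set: 'I_n]%SET * ext_gram Q [set: 'I_n]%SET [set: 'I_n]%SET) => //.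
apply: contraTneq (partial_volume_neq0 ur) => k0; rewrite negbK; apply/eqP.
by apply: (gram_nondeg Qu) => a; rewrite gramE k0 mulr0.
Qed.

End Volume.

(** * The pairing as a weighted top coefficient *)

Section Pairing.
Variables (R : realType) (s : nat) (G : 'M[R]_(2 * s.+1)) (v : coframe R s).
Notation dimX := (2 * s.+1)%N.
Notation Q := (invmx G).
Implicit Types (a b : ext R[i] dimX) (f g : 'End(ext R dimX)).

(** The term [s + 1 + l] comes from the second pairing. The product comes from the first, whose
    exponent is the product of the degrees: against the volume form only degrees [k] and [l] with
    [k + l = dimX] contribute, so [k] is [dimX - l]. *)
Definition pairing_weight (l : nat) : R[i] :=
  imag R ^+ (s + 1 + l + (dimX - l) * l).

Lemma conjc0 : conjc (0 : R[i]) = 0.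
Proof. by apply/eqP; rewrite eq_complex /= oppr0 eqxx. Qed.

Lemma imag_sqr : imag R ^+ 2 = -1.
Proof. exact: sqr_i. Qed.

Lemma imag_neq0 : imag R != 0.
Proof.
apply/eqP => i0; have := imag_sqr; rewrite i0 expr0n /= => /eqP.
by rewrite eq_sym oppr_eq0 oner_eq0.
Qed.

Lemma imag_double k : imag R ^+ k.*2 = (-1) ^+ k.
Proof. by rewrite -mul2n exprM imag_sqr. Qed.

(** With [m = dimX - l - 2] the exponents differ by [2 + 2m - 2l]. As [dimX] is even, [m] and [l]
    have the same parity, and this is 2 modulo 4. *)
Lemma pairing_weightSS l : (l.+2 <= dimX)%N -> pairing_weight l.+2 = - pairing_weight l.
Proof.
move=> ln; rewrite /pairing_weight.
have [m mE] : exists m, dimX = (m + l).+2 by exists (dimX - l.+2)%N; rewrite -addnS -addnS subnK.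
have -> : (dimX - l.+2 = m)%N by rewrite mE -addnS -addnS addnK.
have -> : (dimX - l = m.+2)%N by rewrite mE -!addSn addnK.
have par : odd m = odd l.
  have : odd dimX = false by rewrite mul2n odd_double.
  by rewrite mE /= negbK oddD; case: (odd m); case: (odd l).
have -> : (s + 1 + l.+2 + m * l.+2 = (s + 1 + l + m * l) + 2 + m.*2)%N by lia.
have -> : (s + 1 + l + m.+2 * l = (s + 1 + l + m * l) + l.*2)%N by lia.
rewrite !exprD imag_sqr !imag_double mulrN1 mulNr; congr (- (_ * _)).
by rewrite -signr_odd par signr_odd.
Qed.

Lemma pairing_weight_neq0 l : pairing_weight l != 0.
Proof. by rewrite expf_neq0 // imag_neq0. Qed.

Lemma ext_conj_homogeneous l b :
  ext_conj (homogeneous_part l b) = homogeneous_part l (ext_conj b).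
Proof.
by apply/ffunP => S; rewrite !ffunE; case: ifP => // _; exact: conjc0.
Qed.

Lemma homogeneous_homogeneous k l b :
  homogeneous_part k (homogeneous_part l b) = if k == l then homogeneous_part l b else 0.
Proof.
apply/ffunP => S; rewrite !ffunE; case: (eqVneq k l) => [->|kl]; rewrite ffunE.
  by case: ifP => // ->.
by case: (#|S| =P k) => // ->; rewrite (negPf kl).
Qed.

Hypothesis orth : forall i j i' j',
  (v i j *m Q *m (v i' j')^T) 0 0 = ((i == i') && (j == j'))%:R.
Hypothesis Qu : Q \in unitmx.

Lemma pairing2E : exists2 k : R[i], k != 0 & forall a b,
  pairing2 G v a b = k * top (wedge a (weight pairing_weight (ext_conj b))).
Proof.
have volE : volume_form v = partial_volume v (index_enum 'I_s.+1) by [].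
have [|k k0 gramk] := gram_volume orth Qu (index_enum_uniq 'I_s.+1).
  by rewrite -sum1_size sum_nat_const card_ord muln1 mul2n.
exists (k%:C%C); first by rewrite (inj_eq (@complexI R)).
have hermk x : herm Q x (ext_of_real (volume_form v)) = k%:C%C * top x.
  apply: etrans (herm_ReIm Q erefl erefl (ext_Re_of_real _) (ext_Im_of_real _)) _.
  have g0 z : gram Q z 0 = 0 by apply: linear0.
  rewrite volE !g0 !gramk addr0 subr0 /top !ffunE.
  case: (x _) => x1 x2; apply/eqP; rewrite eq_complex /=; apply/andP; split; apply/eqP; ring.
move=> a b; rewrite -top_wedge_weight mulr_sumr /pairing2; apply: eq_bigr => l _.
rewrite /pairing exchange_big /= (bigD1 l) //= [X in _ + X]big1 ?addr0; last first.
  move=> l' ll'; rewrite big1 // => k' _.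
  rewrite /pairing_term homogeneous_homogeneous val_eqE (negPf ll').
  have -> : ext_conj (0 : ext R[i] dimX) = 0.
    by apply/ffunP => S; rewrite !ffunE; exact: conjc0.
  by rewrite linear0 hermk /top ffunE !mulr0.
rewrite !mulr_sumr; apply: eq_bigr => k' _.
rewrite /pairing_term homogeneous_homogeneous eqxx ext_conj_homogeneous hermk.
(* Only complementary degrees survive, which turns the exponent [k' * l] into a function of [l]
   alone. *)
have [kl|kl] := eqVneq (k' + l)%N dimX; last first.
  by rewrite top_wedge_homogeneous // !mulr0.
have -> : pairing_weight l = imag R ^+ (s + 1 + l) * imag R ^+ (k' * l).
  by rewrite -exprD /pairing_weight -[in X in (X - _)%N]kl addnK.
by rewrite -!mulrA [RHS]mulrCA; congr (_ * _); rewrite [RHS]mulrCA.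
Qed.

End Pairing.

(** * Operators preserving the pairing *)

Section FibreAlgebra.
Variables (R : realType) (s : nat) (G : 'M[R]_(2 * s.+1)) (v : coframe R s).
Notation dimX := (2 * s.+1)%N.
Notation Q := (invmx G).
Notation w := (pairing_weight R s).
Hypothesis orth : forall i j i' j',
  (v i j *m Q *m (v i' j')^T) 0 0 = ((i == i') && (j == j'))%:R.
Hypothesis Qu : Q \in unitmx.
Implicit Types (a b : ext R[i] dimX) (f g : 'End(ext R dimX)).

Definition Lambda_op (j k : 'I_s.+1) : 'End(ext R dimX) :=
  \sum_(i < 2) contract Q (v i k) * contract Q (v i j).
Definition A_op (j : 'I_s.+1) : 'End(ext R dimX) :=
  contract Q (v ord_max j) * contract Q (v ord0 j).

Lemma adjoint_L_op j k : adjoint_wrt Q (L_op v j k) (Lambda_op j k).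
Proof.
rewrite /L_op /Lambda_op !big_ord_recl !big_ord0 !addr0.
rewrite -[X in adjoint_wrt _ (X + _)]scale1r -[X in adjoint_wrt _ _ (X + _)]scale1r.
by apply: adjointL; apply: adjointM; apply: adjoint_covector.
Qed.

Lemma adjoint_V_op j : adjoint_wrt Q (V_op v j) (A_op j).
Proof. by apply: adjointM; apply: adjoint_covector. Qed.

(** The adjoint generators are specified by a relation; since [Q] is invertible the adjoint is
    unique, so they are the explicit contractions. *)
Lemma lie_generatorsP f : lie_generators G v f <->
  (exists j k, j != k /\ (f = L_op v j k \/ f = Lambda_op j k)) \/
  (exists j, f = V_op v j \/ f = A_op j).
Proof.
split=> [[[j [k [jk H]]]|[j H]]|[[j [k [jk H]]]|[j H]]].
- left; exists j, k; split=> //; case: H => [|/herm_adjoint_complexify H]; first by left.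
  by right; exact: adjoint_unique Qu H (adjoint_L_op j k).
- right; exists j; case: H => [|/herm_adjoint_complexify H]; first by left.
  by right; exact: adjoint_unique Qu H (adjoint_V_op j).
- left; exists j, k; split=> //; case: H => [|->]; [by left|right].
  exact/herm_adjoint_complexify/adjoint_L_op.
- right; exists j; case: H => [|->]; [by left|right].
  exact/herm_adjoint_complexify/adjoint_V_op.
Qed.

Lemma complexify_covector (u : 'rV[R]_dimX) :
  complexify (wedge_op (covector u)) = \sum_i (u 0 i)%:C%C *: create R[i] i.
Proof.
rewrite wedge_op_covector complexify_sum; apply: eq_bigr => i _.
rewrite complexifyZ; congr (_ *: _); exact: complexify_create.
Qed.

Lemma complexify_contract (u : 'rV[R]_dimX) :
  complexify (contract Q u) = \sum_i ((u *m Q) 0 i)%:C%C *: annih R[i] i.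
Proof.
rewrite complexify_sum; apply: eq_bigr => i _.
rewrite complexifyZ; congr (_ *: _); exact: complexify_annih.
Qed.

Lemma skew_top_covectors (u u' : 'rV[R]_dimX) :
  skew_top w (complexify (wedge_op (covector u) * wedge_op (covector u'))).
Proof.
have -> := complexifyM (wedge_op (covector u)) (wedge_op (covector u')).
have -> := complexify_covector u; have -> := complexify_covector u'.
apply: skew_top_comb2 => i j; apply: skew_top_create => l.
exact: pairing_weightSS.
Qed.

Lemma skew_top_contracts (u u' : 'rV[R]_dimX) :
  skew_top w (complexify (contract Q u * contract Q u')).
Proof.
have -> := complexifyM (contract Q u) (contract Q u').
have -> := complexify_contract u; have -> := complexify_contract u'.
apply: skew_top_comb2 => i j; apply: skew_top_annih => l.
exact: pairing_weightSS.
Qed.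

Lemma skew_top_generators f : lie_generators G v f -> skew_top w (complexify f).
Proof.
move=> /lie_generatorsP[[j [k [_ [->|->]]]]|[j [->|->]]].
- have -> := complexify_sum (index_enum _) xpredT (fun i => E_op v i j * E_op v i k).
  by apply: skew_top_sum => i; exact: skew_top_covectors.
- have -> := complexify_sum (index_enum _) xpredT (fun i => contract Q (v i k) * contract Q (v i j)).
  by apply: skew_top_sum => i; exact: skew_top_contracts.
- exact: skew_top_covectors.
- exact: skew_top_contracts.
Qed.

Definition top_form a b : R[i] := top (wedge a (weight w (ext_conj b))).

Lemma top_formDl a a' b : top_form (a + a') b = top_form a b + top_form a' b.
Proof. by rewrite /top_form -[a]scale1r wedge_linearl topL mul1r scale1r. Qed.

Lemma top_formZl (k : R[i]) a b : top_form (k *: a) b = k * top_form a b.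
Proof.
by rewrite /top_form -[k *: a]addr0 wedge_linearl wedge0l topL [top 0]ffunE addr0.
Qed.

Lemma top_formNl a b : top_form (- a) b = - top_form a b.
Proof. by rewrite /top_form wedgeNl topN. Qed.

Lemma top_formDr a b b' : top_form a (b + b') = top_form a b + top_form a b'.
Proof.
rewrite /top_form; have -> : ext_conj (b + b') = ext_conj b + ext_conj b'.
  by apply/ffunP => S; rewrite !ffunE; exact: rmorphD.
by rewrite -topD -!linearD.
Qed.

Lemma top_formZr (k : R[i]) a b : top_form a (k *: b) = conjc k * top_form a b.
Proof.
rewrite /top_form; have -> : ext_conj (k *: b) = conjc k *: ext_conj b.
  by apply/ffunP => S; rewrite !ffunE; exact: rmorphM.
by rewrite linearZ /= linearZ /= [LHS]ffunE.
Qed.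

Lemma top_formNr a b : top_form a (- b) = - top_form a b.
Proof. by rewrite -scaleN1r top_formZr rmorphN1 mulN1r. Qed.

Lemma top_form_nondeg a : (forall b, top_form a b = 0) -> a = 0.
Proof.
move=> a0; apply/ffunP => S; rewrite ffunE.
have := a0 (mono R[i] (~: S)%SET); rewrite /top_form.
have -> : weight w (ext_conj (mono R[i] (~: S)%SET)) = w #|(~: S)%SET| *: mono R[i] (~: S)%SET.
  apply/ffunP => T; rewrite !ffunE; case: eqP => [->|_].
    by congr (_ * _); exact: rmorph1.
  by rewrite (rmorph0 conjc) mulr0 [RHS]mulr0.
rewrite linearZ /= [top _]ffunE -[(wedge _ _) _]/(top _) top_wedge_mono.
move/eqP; rewrite scaler_eq0 !mulf_eq0 (negPf (pairing_weight_neq0 _ _ _)).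
by rewrite (negPf (wedge_sign_neq0 _ _ _)) /= => /eqP.
Qed.

End FibreAlgebra.

Section RealForm.
Variables (R : realType) (s : nat) (G : 'M[R]_(2 * s.+1)) (v : coframe R s).
Notation dimX := (2 * s.+1)%N.
Notation Q := (invmx G).
Notation w := (pairing_weight R s).
Notation top_form := (@top_form R s).
Implicit Types (a b : ext R[i] dimX) (f g : 'End(ext R dimX)) (phi psi : 'End(ext R[i] dimX)).

Lemma op_bracketE (F : fieldType) n (p q : 'End(ext F n)) x :
  op_bracket p q x = p (q x) - q (p x).
Proof. by rewrite add_lfunE opp_lfunE !comp_lfunE. Qed.

Definition skew_form phi := forall a b, top_form (phi a) b + top_form a (phi b) = 0.

Lemma skew_formD phi psi : skew_form phi -> skew_form psi -> skew_form (phi + psi).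
Proof.
move=> sphi spsi a b.
by rewrite !add_lfunE top_formDl top_formDr addrACA sphi spsi addr0.
Qed.

Lemma skew_formZ (r : R) phi : skew_form phi -> skew_form (r%:C%C *: phi).
Proof.
move=> sphi a b; rewrite !scale_lfunE top_formZl top_formZr.
have -> : conjc (r%:C%C) = r%:C%C by apply/eqP; rewrite eq_complex /= oppr0 !eqxx.
by rewrite -mulrDr sphi mulr0.
Qed.

Lemma skew_form_bracket phi psi :
  skew_form phi -> skew_form psi -> skew_form (op_bracket phi psi).
Proof.
move=> sphi spsi a b; rewrite !op_bracketE top_formDl top_formDr top_formNl top_formNr.
have sw chi c d : skew_form chi -> top_form (chi c) d = - top_form c (chi d).
  by move=> schi; apply/eqP; rewrite -addr_eq0 schi.
rewrite (sw _ _ _ sphi : top_form (phi (psi a)) b = _) (sw _ a _ spsi).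
rewrite (sw _ _ _ spsi : top_form (psi (phi a)) b = _) (sw _ a _ sphi) !opprK.
by rewrite addrA subrK subrr.
Qed.

(** [skew_top] is a bilinear condition whereas [top_form] conjugates its second argument; for an
    operator commuting with conjugation, as complexified ones do, the two match. *)
Lemma skew_top_form phi :
  (forall a, ext_conj (phi a) = phi (ext_conj a)) -> skew_top w phi -> skew_form phi.
Proof.
move=> conj_phi [topP weightP] a b; rewrite /top_form conj_phi weightP topP.
by rewrite linearN topN addrC addNr.
Qed.

Lemma LR_fibre_subalgebra : real_lie_subalgebra (LR_fibre G v).
Proof.
split=> [A [[A0 _ _ _] _] //|f g fL gL A AP|r f fL A AP|f g fL gL A AP].
- by have [[_ + _ _] _] := AP; apply; [exact: fL | exact: gL].
- by have [[_ _ + _] _] := AP; apply; exact: fL.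
- by have [[_ _ _ +] _] := AP; apply; [exact: fL | exact: gL].
Qed.

Lemma LR_fibre_generators f : lie_generators G v f -> LR_fibre G v f.
Proof. by move=> fg A [_]; apply. Qed.

Hypothesis orth : forall i j i' j',
  (v i j *m Q *m (v i' j')^T) 0 0 = ((i == i') && (j == j'))%:R.
Hypothesis Qu : Q \in unitmx.

(** By minimality of the generated algebra: the operators with skew complexification form a real Lie
    subalgebra containing the generators. *)
Lemma LR_fibre_skew f : LR_fibre G v f -> skew_form (complexify f).
Proof.
move=> fL; apply: (fL [set f | skew_form (complexify f)]); split; last first.
  move=> g /(skew_top_generators Qu); apply: skew_top_form => a.
  exact: ext_conj_complexify.
split=> [|g h sg sh|r g sg|g h sg sh] /=.
- have -> := @complexify0 R dimX; rewrite -(scale0r 0).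
  apply: (@skew_formZ 0) => a b; rewrite !zero_lfunE.
  have := top_formZl 0 0 b; rewrite scale0r mul0r => ->.
  by have := top_formZr 0 a 0; rewrite scale0r (rmorph0 conjc) mul0r add0r.
- exact: (@eq_ind_r _ _ skew_form (skew_formD sg sh) _ (complexifyD g h)).
- exact: (@eq_ind_r _ _ skew_form (skew_formZ r sg) _ (complexifyZ r g)).
- exact: (@eq_ind_r _ _ skew_form (skew_form_bracket sg sh) _ (complexify_bracket g h)).
Qed.

Lemma preserves_pairing2 phi : preserves (pairing2 G v) phi <-> skew_form phi.
Proof.
have [k k0 pE] := pairing2E orth Qu.
split=> sphi a b; last by rewrite !pE -mulrDr [X in _ * X]sphi mulr0.
by apply: (mulfI k0); rewrite mulrDr mulr0 -[RHS](sphi a b) !pE.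
Qed.

Lemma LR_fibre_real_form :
  complexify (n := dimX) @` LR_fibre G v = LC_fibre G v `&` preserves (pairing2 G v).
Proof.
have [L0 LD LZ _] := LR_fibre_subalgebra.
apply/seteqP; split=> phi.
  move=> [f fL <-]; split; last exact/preserves_pairing2/LR_fibre_skew.
  exists f, 0; split=> //.
  by have -> := @complexify0 R dimX; rewrite scaler0 addr0.
move=> [[f [g [fL gL phiE]]] /preserves_pairing2 sphi].
suff g0 : complexify g = 0 by exists f => //; rewrite phiE g0 scaler0 addr0.
move: (LR_fibre_skew fL) (LR_fibre_skew gL) => sf sg; apply/lfunP => a; rewrite zero_lfunE.
move: sphi sf sg; rewrite phiE; move: (complexify f) (complexify g) => F H sphi sf sg.
apply: top_form_nondeg => b; have := sphi a b.
rewrite !add_lfunE !scale_lfunE top_formDl top_formDr addrACA sf add0r top_formZl top_formZr.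
(* The second argument conjugates the scalar while [H] is skew, so the two terms do not cancel but
   add up to [2 * imag * top_form (H a) b]. *)
have -> : conjc (imag R) = - imag R by apply/eqP; rewrite eq_complex /= oppr0 !eqxx.
have -> : top_form a (H b) = - top_form (H a) b.
  by apply/eqP; rewrite -addr_eq0 addrC sg.
rewrite mulrNN -mulr2n => /eqP; rewrite mulrn_eq0 /= mulf_eq0 (negPf (imag_neq0 R)) /=.
by move/eqP.
Qed.

End RealForm.

(** * The split unitary algebra *)

Section QuadraticOperators.
Variables (K : fieldType) (V : vectType K) (m : nat) (al be : 'I_m -> 'End(V)).
Hypothesis alal : forall p q, al p * al q = - (al q * al p).
Hypothesis bebe : forall p q, be p * be q = - (be q * be p).
Hypothesis beal : forall p q, be p * al q + al q * be p = (p == q)%:R *: (1 : 'End(V)).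
Implicit Types (M N : 'M[K]_m) (f g : 'End(V)).

(** Second quantisation of [M]: by commutators it acts on the span of the [al] as [M], and on the
    span of the [be] as minus the transpose. *)
Definition quad M : 'End(V) := \sum_p \sum_q M p q *: (al p * be q).

Lemma quad_linear : linear quad.
Proof.
move=> c M N; rewrite /quad scaler_sumr -big_split; apply: eq_bigr => p _.
rewrite scaler_sumr -big_split; apply: eq_bigr => q _.
by rewrite !mxE scalerDl scalerA.
Qed.
HB.instance Definition _ :=
  GRing.isLinear.Build K 'M[K]_m 'End(V) _ quad quad_linear.

Lemma beal_swap p q : be p * al q = (p == q)%:R *: (1 : 'End(V)) - al q * be p.
Proof. by rewrite -beal addrK. Qed.

Lemma quad_al M r : quad M * al r - al r * quad M = \sum_p M p r *: al p.
Proof.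
rewrite /quad mulr_suml mulr_sumr -sumrB; apply: eq_bigr => p _.
rewrite mulr_suml mulr_sumr -sumrB (bigD1 r) //= big1 ?addr0 => [|q qr].
  rewrite scale_lfunAl scale_lfunAr -scalerBr -mulrA beal_swap eqxx scale1r mulrBr mulr1.
  by rewrite !mulrA (alal r p) mulNr opprK subrK.
rewrite scale_lfunAl scale_lfunAr -scalerBr -mulrA beal_swap (negPf qr) scale0r sub0r.
by rewrite mulrN !mulrA (alal r p) mulNr opprK addNr scaler0.
Qed.

Lemma quad_be M r : quad M * be r - be r * quad M = - \sum_q M r q *: be q.
Proof.
rewrite /quad mulr_suml mulr_sumr -sumrB (bigD1 r) //= [X in _ + X]big1 ?addr0 => [|p pr].
  rewrite mulr_suml mulr_sumr -sumrB -sumrN; apply: eq_bigr => q _.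
  rewrite scale_lfunAl scale_lfunAr -scalerBr -scalerN mulrA beal_swap eqxx scale1r mulrBl mul1r.
  by rewrite -!mulrA (bebe r q) mulrN opprK opprD addrCA subrr addr0.
rewrite mulr_suml mulr_sumr -sumrB big1 // => q _.
rewrite scale_lfunAl scale_lfunAr -scalerBr mulrA beal_swap eq_sym (negPf pr) scale0r sub0r.
by rewrite mulNr opprK -!mulrA (bebe r q) mulrN subrr scaler0.
Qed.

(** Commutation with [quad M] is a derivation. Applied to the products [al r * be t] in [quad N],
    its effect on [al] yields [M *m N] and its effect on [be] yields [- N *m M]. *)
Lemma quad_bracket M N : quad (M *m N - N *m M) = quad M * quad N - quad N * quad M.
Proof.
have derive (X : 'End(V)) : X * quad N - quad N * X =
  \sum_r \sum_t N r t *: ((X * al r - al r * X) * be t + al r * (X * be t - be t * X)).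
  rewrite /quad mulr_suml mulr_sumr -sumrB; apply: eq_bigr => r _.
  rewrite mulr_suml mulr_sumr -sumrB; apply: eq_bigr => t _.
  rewrite scale_lfunAl scale_lfunAr -scalerBr; congr (_ *: _).
  by rewrite mulrBl mulrBr !mulrA addrA subrK.
rewrite derive.
rewrite linearB /=.
under [RHS]eq_bigr => r _.
  under eq_bigr => t _ do rewrite quad_al quad_be mulrN scalerBr.
  rewrite sumrB; over.
rewrite sumrB; congr (_ - _).
- rewrite /quad.
  under [RHS]eq_bigr => r _.
    under eq_bigr => t _ do rewrite mulr_suml scaler_sumr.
    rewrite exchange_big /=; over.
  rewrite [RHS]exchange_big; apply: eq_bigr => p _ /=.
  rewrite [RHS]exchange_big; apply: eq_bigr => t _ /=.
  rewrite mxE scaler_suml; apply: eq_bigr => r _.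
  by rewrite scale_lfunAl scalerA mulrC.
- rewrite /quad; apply: eq_bigr => r _.
  under [RHS]eq_bigr => t _ do rewrite mulr_sumr scaler_sumr.
  rewrite [RHS]exchange_big; apply: eq_bigr => q _ /=.
  rewrite mxE scaler_suml; apply: eq_bigr => t _.
  by rewrite scale_lfunAr scalerA.
Qed.

Lemma quad_delta p q : quad (delta_mx p q) = al p * be q.
Proof.
rewrite /quad (bigD1 p) //= [X in _ + X]big1 ?addr0 => [|p' pp'].
  rewrite (bigD1 q) //= big1 ?addr0 => [|q' qq']; rewrite mxE eqxx ?eqxx ?scale1r //.
  by rewrite (negPf qq') scale0r.
by rewrite big1 // => q' _; rewrite mxE (negPf pp') scale0r.
Qed.

(** [M] can be read off: the commutator with [al r] gives column [r] as a combination of the [al],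
    and the anticommutator with [be q] extracts the entry [M q r]. *)
Lemma quad_inj : (1 : 'End(V)) != 0 -> injective quad.
Proof.
move=> one0; apply: raddf_inj => M M0; apply/matrixP => q r; rewrite mxE.
have := quad_al M r; rewrite M0 mul0r mulr0 subrr => al0.
have : be q * (\sum_p M p r *: al p) + (\sum_p M p r *: al p) * be q = M q r *: (1 : 'End(V)).
  rewrite mulr_suml mulr_sumr -big_split (bigD1 q) //= big1 ?addr0 => [|p pq].
    by rewrite scale_lfunAl scale_lfunAr -scalerDr beal eqxx scale1r.
  by rewrite scale_lfunAl scale_lfunAr -scalerDr beal eq_sym (negPf pq) scale0r scaler0.
rewrite -al0 mulr0 mul0r addr0 => /esym/eqP; rewrite scaler_eq0 (negPf one0) orbF.
by move/eqP.
Qed.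

End QuadraticOperators.

(** * Block structure and generation of su for the split form *)

Section SplitUnitary.
Variables (C : fieldType) (cj : {rmorphism C -> C}) (im : C).
Hypothesis cjK : involutive cj.
Hypothesis im_sqr : im * im = -1.
Hypothesis cj_im : cj im = - im.
Hypothesis two_neq0 : 2%:R != 0 :> C.

Definition star m n (M : 'M[C]_(m, n)) : 'M[C]_(n, m) := (map_mx cj M)^T.

Lemma starD m n (M M' : 'M[C]_(m, n)) : star (M + M') = star M + star M'.
Proof. by rewrite /star map_mxD linearD. Qed.

Lemma starN m n (M : 'M[C]_(m, n)) : star (- M) = - star M.
Proof. by rewrite /star map_mxN linearN. Qed.

Lemma starM m n p (M : 'M[C]_(m, n)) (M' : 'M[C]_(n, p)) : star (M *m M') = star M' *m star M.
Proof. by rewrite /star map_mxM trmx_mul. Qed.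

Lemma starZ m n c (M : 'M[C]_(m, n)) : star (c *: M) = cj c *: star M.
Proof. by rewrite /star map_mxZ linearZ. Qed.

Lemma star_delta m n i j : star (delta_mx i j : 'M[C]_(m, n)) = delta_mx j i.
Proof. by rewrite /star map_delta_mx trmx_delta. Qed.

Lemma real_imaginary (z : C) : exists x y, [/\ cj x = x, cj y = y & z = x + im * y].
Proof.
have cj2 : cj 2%:R^-1 = 2%:R^-1 by rewrite fmorphV rmorph_nat.
exists (2%:R^-1 * (z + cj z)), (2%:R^-1 * (im * (cj z - z))); split.
- by rewrite rmorphM cj2 rmorphD cjK addrC.
- by rewrite !rmorphM cj2 cj_im rmorphB cjK mulNr -mulrN opprB.
- rewrite mulrCA -mulrDr mulrA im_sqr mulN1r opprB addrACA subrr addr0.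
  by rewrite -[X in _ = _ * X]mulr2n -[X in _ = _ * X]mulr_natl mulKf.
Qed.

Variable N : nat.
Hypothesis N3 : (2 < N)%N.
Implicit Types (A B D : 'M[C]_N) (M : 'M[C]_(N + N)).

(* The Hermitian form of signature (N, N) preserved by the matrices of real
   operators: complex conjugation exchanges the two halves of the indices. *)
Definition flip : 'M[C]_(N + N) := block_mx 0 1%:M 1%:M 0.
Definition split_su M := star M *m flip + flip *m M = 0 /\ \tr M = 0.

(** The three blocks form a grading; acting on forms, [upper], [levi] and [lower] will change the
    degree by 2, 0 and -2. *)
Definition upper B : 'M[C]_(N + N) := block_mx 0 B 0 0.
Definition lower B : 'M[C]_(N + N) := block_mx 0 0 B 0.
Definition levi A : 'M[C]_(N + N) := block_mx A 0 0 (- star A).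

Definition commutator M M' := M *m M' - M' *m M.

(** The form condition makes the lower right block [- star A]; the trace is then [\tr A] minus its
    conjugate, so the trace condition says exactly that [\tr A] is real. *)
Lemma split_suP M : split_su M ->
  exists A B D, [/\ star B = - B, star D = - D, cj (\tr A) = \tr A &
                    M = levi A + upper B + lower D].
Proof.
case=> MK tr0; rewrite -(submxK M) in MK tr0 *.
move: (ulsubmx M) (ursubmx M) (dlsubmx M) (drsubmx M) MK tr0 => A B D E.
have -> : star (block_mx A B D E) = block_mx (star A) (star D) (star B) (star E).
  by rewrite /star map_block_mx tr_block_mx.
rewrite /flip !mulmx_block !(mulmx0, mul0mx, mulmx1, mul1mx, addr0, add0r) add_block_mx.
move=> blk; have [dD aE eA bB] := eq_block_mx (etrans blk (esym (block_mx0 _ _ _ _ _))).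
rewrite mxtrace_block => tr0; exists A, B, D; split.
- by apply/eqP; rewrite -addr_eq0 bB.
- by apply/eqP; rewrite -addr_eq0 dD.
- have E_ : E = - star A by apply/eqP; rewrite -addr_eq0 addrC aE.
  have trs : \tr (star A) = cj (\tr A) by rewrite /star mxtrace_tr trace_map_mx.
  by move/eqP: tr0; rewrite E_ linearN /= trs subr_eq0 => /eqP.
- rewrite /levi /upper /lower !add_block_mx !(addr0, add0r); congr block_mx.
  by apply/eqP; rewrite -addr_eq0 addrC aE.
Qed.

Lemma commutator_upper_lower B D : star B = - B -> star D = - D ->
  commutator (upper B) (lower D) = levi (B *m D).
Proof.
move=> sB sD; rewrite /commutator /upper /lower /levi !mulmx_block.
rewrite !(mulmx0, mul0mx, addr0, add0r) opp_block_mx add_block_mx !(subr0, sub0r, oppr0).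
by rewrite starM sB sD mulmxN mulNmx opprK.
Qed.

Lemma commutator_levi_upper A B : commutator (levi A) (upper B) = upper (A *m B + B *m star A).
Proof.
rewrite /commutator /upper /levi !mulmx_block.
rewrite !(mulmx0, mul0mx, addr0, add0r) opp_block_mx add_block_mx !(subr0, sub0r, oppr0).
by rewrite mulmxN opprK.
Qed.

Lemma commutator_levi_lower A D :
  commutator (levi A) (lower D) = lower (- (star A *m D + D *m A)).
Proof.
rewrite /commutator /lower /levi !mulmx_block.
rewrite !(mulmx0, mul0mx, addr0, add0r) opp_block_mx add_block_mx !(subr0, sub0r, oppr0).
by rewrite mulNmx opprD.
Qed.

Lemma split_su0 : split_su 0.
Proof. by rewrite /split_su mxtrace0 mulmx0 addr0 /star map_mx0 trmx0 mul0mx. Qed.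

Lemma split_suD M M' : split_su M -> split_su M' -> split_su (M + M').
Proof.
move=> [M0 t0] [M0' t0']; split; last by rewrite mxtraceD t0 t0' addr0.
by rewrite starD mulmxDl mulmxDr addrACA M0 M0' addr0.
Qed.

Lemma split_suZ r M : cj r = r -> split_su M -> split_su (r *: M).
Proof.
move=> rr [M0 t0]; split; last by rewrite mxtraceZ t0 mulr0.
by rewrite starZ rr -scalemxAl -scalemxAr -scalerDr M0 scaler0.
Qed.

Lemma split_su_commutator M M' : split_su M -> split_su M' -> split_su (commutator M M').
Proof.
move=> [M0 _] [M0' _]; split; last by rewrite linearB /= mxtrace_mulC subrr.
have fM X : star X *m flip + flip *m X = 0 -> star X *m flip = - (flip *m X).
  by move=> X0; apply/eqP; rewrite -addr_eq0 X0.
rewrite /commutator starD starN !starM mulmxDl mulNmx mulmxDr mulmxN.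
rewrite -!mulmxA (fM _ M0) (fM _ M0') !mulmxN !mulmxA (fM _ M0) (fM _ M0').
by rewrite !mulNmx !opprK addrA subrK subrr.
Qed.

Lemma split_su_upper B : star B = - B -> split_su (upper B).
Proof.
move=> sB; split; last by rewrite mxtrace_block !mxtrace0 addr0.
rewrite /star /upper map_block_mx tr_block_mx !map_mx0 !trmx0 -/(star B) sB.
rewrite /flip !mulmx_block !(mulmx0, mul0mx, mulmx1, mul1mx, addr0, add0r) add_block_mx.
by rewrite !addr0 addNr block_mx0.
Qed.

Lemma split_su_lower D : star D = - D -> split_su (lower D).
Proof.
move=> sD; split; last by rewrite mxtrace_block !mxtrace0 addr0.
rewrite /star /lower map_block_mx tr_block_mx !map_mx0 !trmx0 -/(star D) sD.
rewrite /flip !mulmx_block !(mulmx0, mul0mx, mulmx1, mul1mx, addr0, add0r) add_block_mx.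
by rewrite !addr0 addNr block_mx0.
Qed.

Section Generation.
Variable P : 'M[C]_(N + N) -> Prop.
Hypothesis P0 : P 0.
Hypothesis PD : forall M M', P M -> P M' -> P (M + M').
Hypothesis PZ : forall r M, cj r = r -> P M -> P (r *: M).
Hypothesis PC : forall M M', P M -> P M' -> P (commutator M M').
Notation e j k := (delta_mx j k : 'M[C]_N).
Hypothesis Pu : forall j k, j != k -> P (upper (e j k - e k j)).
Hypothesis Pui : forall j, P (upper (im *: e j j)).
Hypothesis Pl : forall j k, j != k -> P (lower (e j k - e k j)).
Hypothesis Pli : forall j, P (lower (im *: e j j)).

Lemma upperL r B B' : upper (r *: B + B') = r *: upper B + upper B'.
Proof. by rewrite /upper scale_block_mx add_block_mx !scaler0 !addr0. Qed.

Lemma lowerL r B B' : lower (r *: B + B') = r *: lower B + lower B'.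
Proof. by rewrite /lower scale_block_mx add_block_mx !scaler0 !addr0. Qed.

Lemma leviL r A A' : cj r = r -> levi (r *: A + A') = r *: levi A + levi A'.
Proof.
move=> rr; rewrite /levi scale_block_mx add_block_mx !scaler0 !addr0 starD starZ rr.
by rewrite opprD scalerN.
Qed.

Lemma mul_e j k l m : e j k *m e l m = (k == l)%:R *: e j m.
Proof. by rewrite mul_delta_mx_cond scaler_nat. Qed.

Lemma star_skew j k : star (e j k - e k j) = - (e j k - e k j).
Proof. by rewrite starD starN !star_delta opprB. Qed.

Lemma star_imag j : star (im *: e j j) = - (im *: e j j).
Proof. by rewrite starZ cj_im star_delta scaleNr. Qed.

Lemma star_sym j k : star (im *: e j k + im *: e k j) = - (im *: e j k + im *: e k j).
Proof. by rewrite starD !starZ cj_im !star_delta !scaleNr -opprD addrC. Qed.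

(* Here [s >= 2] is essential: for [s = 1] the generators span too small an algebra. *)
Lemma third_index (j k : 'I_N) : exists2 l, j != l & l != k.
Proof.
have : (0 < #|[set~ j] :\ k|)%N.
  have := cardsD1 k [set~ j]; rewrite cardsC1 card_ord => cN.
  by rewrite lt0n; apply: contraTneq N3 => c0; move: cN; rewrite c0; case: (_ \in _) => /=; lia.
by case/card_gt0P => l; rewrite !inE => /andP[lk lj]; exists l => //; rewrite eq_sym.
Qed.

(** Two real skew matrices that share only the index [l] have a single matrix unit as product. *)
Lemma levi_offdiag j k : j != k -> P (levi (e j k)).
Proof.
move=> jk; have [l jl lk] := third_index j k.
have -> : e j k = (e j l - e l j) *m (e l k - e k l).
  rewrite mulmxBl !mulmxBr !mul_e eqxx (negPf jl) (negPf jk) (negPf lk) !scale0r.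
  by rewrite scale1r !subr0.
rewrite -commutator_upper_lower; [|exact: star_skew..].
by apply: PC; [exact: Pu | exact: Pl].
Qed.

Lemma levi_imag_offdiag j k : j != k -> P (levi (im *: e j k)).
Proof.
move=> jk; have -> : im *: e j k = (im *: e j j) *m (e j k - e k j).
  by rewrite -scalemxAl mulmxBr !mul_e eqxx (negPf jk) scale0r subr0 scale1r.
rewrite -commutator_upper_lower; [|exact: star_imag|exact: star_skew].
by apply: PC; [exact: Pui | exact: Pl].
Qed.

(** No generator is an imaginary symmetric off-diagonal block; the degree-zero element
    [levi (e j k)] produces it from the diagonal [im *: e k k]. *)
Lemma upper_sym j k : j != k -> P (upper (im *: e j k + im *: e k j)).
Proof.
move=> jk; have -> : im *: e j k + im *: e k j = e j k *m (im *: e k k) + (im *: e k k) *m star (e j k).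
  by rewrite star_delta -scalemxAl -scalemxAr !mul_e eqxx !scale1r.
by rewrite -commutator_levi_upper; apply: PC; [exact: levi_offdiag|exact: Pui].
Qed.

Lemma lower_sym j k : j != k -> P (lower (im *: e j k + im *: e k j)).
Proof.
move=> jk; have -> : im *: e j k + im *: e k j =
    -1 *: - (star (e j k) *m (im *: e j j) + (im *: e j j) *m e j k) + 0.
  by rewrite star_delta -scalemxAl -scalemxAr !mul_e eqxx !scale1r scaleN1r opprK addr0 addrC.
rewrite lowerL -commutator_levi_lower [lower 0]block_mx0 addr0.
by apply: PZ; [rewrite rmorphN1 | apply: PC; [exact: levi_offdiag|exact: Pli]].
Qed.

Lemma levi_diag j : P (levi (e j j)).
Proof.
have -> : e j j = -1 *: ((im *: e j j) *m (im *: e j j)) + 0.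
  by rewrite -scalemxAl -scalemxAr !mul_e eqxx scale1r !scalerA -mulrA im_sqr mulrNN mulr1 scale1r addr0.
have levi0 : levi 0 = 0 by rewrite /levi /star map_mx0 trmx0 oppr0 block_mx0.
rewrite leviL ?rmorphN1 // levi0 addr0; apply: PZ; first by rewrite rmorphN1.
rewrite -commutator_upper_lower; [|exact: star_imag..].
by apply: PC; [exact: Pui | exact: Pli].
Qed.

(** Only differences occur: [levi (im *: e j j)] by itself has trace [2 * im] and lies outside the
    algebra. *)
Lemma levi_imag_diag j k : P (levi (im *: (e j j - e k k))).
Proof.
have [->|jk] := eqVneq j k.
  by rewrite subrr scaler0 /levi /star map_mx0 trmx0 oppr0 block_mx0.
have -> : im *: (e j j - e k k) = (e j k - e k j) *m (im *: e j k + im *: e k j).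
  rewrite mulmxBl !mulmxDr -!scalemxAr !mul_e !eqxx [k == j]eq_sym (negPf jk) !scale0r !scaler0.
  by rewrite add0r addr0 !scale1r scalerBr.
rewrite -commutator_upper_lower; [|exact: star_skew|exact: star_sym].
by apply: PC; [exact: Pu | exact: lower_sym].
Qed.

(** [B] is expanded as half of [B - star B], so that every summand is itself skew-Hermitian; single
    matrix units would leave the algebra. *)
Lemma skew_sum B : star B = - B ->
  B = \sum_j \sum_k 2%:R^-1 *: (B j k *: e j k - cj (B j k) *: e k j).
Proof.
move=> sB; under eq_bigr do rewrite -scaler_sumr sumrB.
rewrite -scaler_sumr sumrB -matrix_sum_delta.
have -> : \sum_j \sum_k cj (B j k) *: e k j = star B.
  rewrite exchange_big [RHS]matrix_sum_delta /=; apply: eq_bigr => k _.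
  by apply: eq_bigr => j _; rewrite !mxE.
by rewrite sB opprK -mulr2n -scaler_nat scalerA mulVf // scale1r.
Qed.

(** Serves for [f] equal to [upper] and to [lower]. Splitting an entry as [x + im * y] writes its
    skew-Hermitian summand as a real skew matrix times [x] plus an imaginary symmetric one times
    [y]. *)
Lemma skew_generated (f : 'M[C]_N -> 'M[C]_(N + N)) :
  (forall r B B', f (r *: B + B') = r *: f B + f B') ->
  (forall j k, j != k -> P (f (e j k - e k j))) ->
  (forall j, P (f (im *: e j j))) ->
  (forall j k, j != k -> P (f (im *: e j k + im *: e k j))) ->
  forall B, star B = - B -> P (f B).
Proof.
move=> fL fa fi fs B sB.
have f0 : f 0 = 0 by rewrite -(subrr 0) addrC -scaleN1r fL scaleN1r addNr.
have fD B1 B2 : f (B1 + B2) = f B1 + f B2 by rewrite -[B1]scale1r fL !scale1r.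
have fZ r B1 : f (r *: B1) = r *: f B1 by rewrite -[r *: B1]addr0 fL f0 addr0.
rewrite (skew_sum sB).
elim/big_rec: _ => [|j X _ PX]; first by rewrite f0.
rewrite fD; apply: PD => //.
elim/big_rec: _ => [|k Y _ PY]; first by rewrite f0.
rewrite fD; apply: PD => //; rewrite fZ; apply: PZ; first by rewrite fmorphV rmorph_nat.
have [x [y [cx cy ->]]] := real_imaginary (B j k).
have -> : (x + im * y) *: e j k - cj (x + im * y) *: e k j
        = x *: (e j k - e k j) + y *: (im *: e j k + im *: e k j).
  rewrite rmorphD rmorphM cx cy cj_im mulNr scalerBl !scalerDl scalerBr scalerDr !scalerA.
  by rewrite opprB -!addrA; congr (_ + _); rewrite addrCA [y * im]mulrC [RHS]addrCA addrCA; congr (_ + _); rewrite addrC.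
rewrite fD !fZ; apply: PD; apply: PZ => //.
  by have [->|jk] := eqVneq j k; [rewrite subrr f0 | exact: fa].
(* On the diagonal the symmetric matrix is twice [im *: e j j]. *)
have [->|jk] := eqVneq j k; last exact: fs.
by rewrite fD; apply: PD.
Qed.

Lemma levi_generated A : cj (\tr A) = \tr A -> P (levi A).
Proof.
move=> trA; have levi0 : levi 0 = 0 by rewrite /levi /star map_mx0 trmx0 oppr0 block_mx0.
have cj1 : cj 1 = 1 by rewrite rmorph1.
have lD A1 A2 : levi (A1 + A2) = levi A1 + levi A2 by rewrite -[A1]scale1r leviL // !scale1r.
have lZ r A1 : cj r = r -> levi (r *: A1) = r *: levi A1.
  by move=> rr; rewrite -[r *: A1]addr0 leviL // levi0 addr0.
have Psum (I : Type) (s : seq I) (Q : pred I) (h : I -> 'M[C]_N) :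
    (forall i, Q i -> P (levi (h i))) -> P (levi (\sum_(i <- s | Q i) h i)).
  move=> Ph; elim/big_rec: _ => [|i X Qi PX]; first by rewrite levi0.
  by rewrite lD; apply: PD => //; apply: Ph.
pose i0 := Ordinal (ltn_trans (isT : 0 < 2)%N N3).
(* [z j] is the imaginary part of [A j j]. Since the trace is real these add up to 0, so each
   [im *: e j j] may be replaced by its difference with the fixed [im *: e i0 i0], which is covered
   by [levi_imag_diag]. *)
pose z j := im * 2%:R^-1 * (cj (A j j) - A j j).
have cj2 : cj 2%:R^-1 = 2%:R^-1 by rewrite fmorphV rmorph_nat.
have cz j : cj (z j) = z j.
  by rewrite /z !rmorphM cj2 cj_im rmorphB cjK; ring.
have cr j : cj (A j j - im * z j) = A j j - im * z j.
  have -> : A j j - im * z j = 2%:R^-1 * (cj (A j j) + A j j).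
    by rewrite /z !mulrA im_sqr; field.
  by rewrite rmorphM cj2 rmorphD cjK addrC.
have zsum : \sum_j z j = 0.
  by rewrite -mulr_sumr sumrB -[X in _ * (X - _)]rmorph_sum -/(\tr A) trA subrr mulr0.
have -> : A = \sum_j \sum_(k | j != k) A j k *: e j k +
    (\sum_j (A j j - im * z j) *: e j j + \sum_j z j *: (im *: (e j j - e i0 i0))).
  have -> : \sum_j z j *: (im *: (e j j - e i0 i0)) = \sum_j (im * z j) *: e j j.
    under eq_bigr do rewrite scalerA mulrC scalerBr.
    by rewrite sumrB -scaler_suml -mulr_sumr zsum mulr0 scale0r subr0.
  rewrite -big_split /= -big_split /= [LHS]matrix_sum_delta; apply: eq_bigr => j _.
  rewrite (bigD1 j) //= addrC -scalerDl subrK; congr (_ + _).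
  by apply: eq_bigl => k; rewrite eq_sym.
have Pz c j k : j != k -> P (levi (c *: e j k)).
  move=> jk; have [x [y [cx cy ->]]] := real_imaginary c.
  rewrite scalerDl mulrC -scalerA lD (lZ x) // (lZ y) //.
  by apply: PD; apply: PZ => //; [exact: levi_offdiag | exact: levi_imag_offdiag].
rewrite !lD; apply: PD; last apply: PD.
- by apply: (Psum) => j _; apply: (Psum) => k; exact: Pz.
- apply: (Psum) => j _; rewrite lZ //; apply: PZ => //; exact: levi_diag.
- by apply: (Psum) => j _; rewrite lZ //; apply: PZ => //; exact: levi_imag_diag.
Qed.

Lemma split_su_generated M : split_su M -> P M.
Proof.
case/split_suP => A [B [D [sB sD trA ->]]]; apply: PD; first apply: PD.
- exact: levi_generated.
- by apply: (skew_generated upperL) => //; exact: upper_sym.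
- by apply: (skew_generated lowerL) => //; exact: lower_sym.
Qed.

End Generation.
End SplitUnitary.

(** * From the split form to the diagonal form of signature (N, N) *)

Section Cayley.
Variables (C : fieldType) (cj : {rmorphism C -> C}) (N : nat).
Hypothesis two_neq0 : 2%:R != 0 :> C.
Implicit Types (M J : 'M[C]_(N + N)).

Definition hadamard : 'M[C]_(N + N) := block_mx 1%:M 1%:M 1%:M (- 1%:M).
Definition signature : 'M[C]_(N + N) := block_mx 1%:M 0 0 (- 1%:M).
(** Conjugation by [hadamard], whose inverse is half of itself. Its columns are eigenvectors of
    [flip], so the split form becomes diagonal. *)
Definition cayley M : 'M[C]_(N + N) := 2%:R^-1 *: (hadamard *m M *m hadamard).

Lemma hadamard_sqr : hadamard *m hadamard = 2%:R%:M.
Proof.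
rewrite /hadamard mulmx_block !mulmx1 !mul1mx mulmxN mulmx1 opprK subrr.
by rewrite [RHS]scalar_mx_block -raddfD.
Qed.

Lemma cayleyK : involutive cayley.
Proof.
move=> M; rewrite /cayley -scalemxAr -scalemxAl scalerA.
rewrite !mulmxA hadamard_sqr -[_ *m _ *m hadamard]mulmxA hadamard_sqr.
rewrite mul_mx_scalar mul_scalar_mx !scalerA -!mulrA.
by rewrite mulrA mulrACA !mulVf // mul1r scale1r.
Qed.

Lemma cayleyM M M' : cayley (M *m M') = cayley M *m cayley M'.
Proof.
rewrite /cayley -scalemxAl -scalemxAr scalerA.
rewrite !mulmxA -[_ *m hadamard *m hadamard]mulmxA hadamard_sqr mul_mx_scalar.
by rewrite -!scalemxAl scalerA -mulrA mulVf ?mulr1.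
Qed.

Lemma cayley_linear : linear cayley.
Proof.
move=> c M M'; rewrite /cayley mulmxDr mulmxDl scalerDr; congr (_ + _).
by rewrite -scalemxAr -scalemxAl !scalerA mulrC.
Qed.
HB.instance Definition _ :=
  GRing.isLinear.Build C 'M[C]_(N + N) 'M[C]_(N + N) _ cayley cayley_linear.

Lemma cayley_commutator M M' :
  cayley (commutator M M') = cayley M *m cayley M' - cayley M' *m cayley M.
Proof. by rewrite /commutator linearB /= !cayleyM. Qed.

Lemma cayley_flip : cayley (flip C N) = signature.
Proof.
rewrite /cayley /flip /hadamard !mulmx_block !(mulmx0, mul0mx, mulmx1, mul1mx, addr0, add0r).
rewrite subrr addNr scale_block_mx !scaler0 /signature.
have half2 : 2%:R^-1 *: (1%:M + 1%:M) = 1%:M :> 'M[C]_N.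
  by rewrite -mulr2n -scaler_nat scalerA mulVf // scale1r.
by rewrite -opprD scalerN half2.
Qed.

Lemma star_hadamard : star cj hadamard = hadamard.
Proof.
by rewrite /star map_block_mx tr_block_mx !map_mxN !map_mx1 linearN /= !trmx1.
Qed.

Lemma star_cayley M : star cj (cayley M) = cayley (star cj M).
Proof.
by rewrite /cayley starZ fmorphV rmorph_nat !starM star_hadamard mulmxA.
Qed.

Lemma cayley_preserves J M :
  star cj M *m J + J *m M = 0 -> star cj (cayley M) *m cayley J + cayley J *m cayley M = 0.
Proof. by move=> MJ; rewrite star_cayley -!cayleyM -linearD /= MJ linear0. Qed.

Lemma trace_cayley M : \tr (cayley M) = \tr M.
Proof.
rewrite /cayley mxtraceZ mxtrace_mulC mulmxA hadamard_sqr mul_scalar_mx mxtraceZ.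
by rewrite mulrA mulVf ?mul1r.
Qed.

Lemma split_su_cayley M :
  split_su cj M <-> star cj (cayley M) *m signature + signature *m cayley M = 0 /\ \tr (cayley M) = 0.
Proof.
rewrite trace_cayley /split_su -cayley_flip; split=> -[MJ tr0]; split=> //.
  exact: cayley_preserves.
by rewrite -(cayleyK M) -(cayleyK (flip C N)); apply: cayley_preserves.
Qed.

End Cayley.

(** * Complex combinations of real anticommuting operators *)

Section Oscillators.
Variables (K : fieldType) (V : vectType K) (im : K) (m : nat) (tau : 'I_m -> 'I_m).
Variable (x : 'I_2 -> 'I_m -> 'End(V)).
Hypothesis im_sqr : im * im = -1.
Hypothesis two_neq0 : 2%:R != 0 :> K.
Hypothesis tauK : involutive tau.
Hypothesis car : forall i p i' q,
  x i p * x i' q + x i' q * x i p = ((i == i') && (q == tau p))%:R *: (1 : 'End(V)).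

Notation x0 := (x ord0).
Notation x1 := (x ord_max).

(* Up to scaling, wedge products with [v_1j + i v_2j] for [p] in the first half
   of the indices, contractions dual to [v_1j - i v_2j] in the second half; the
   [osc_be] are the dual family. *)
Definition osc_al p := x0 p + im *: x1 p.
Definition osc_be p := 2%:R^-1 *: (x0 (tau p) - im *: x1 (tau p)).

Definition acomm (f g : 'End(V)) := f * g + g * f.

Lemma acommDl f f' g : acomm (f + f') g = acomm f g + acomm f' g.
Proof. by rewrite /acomm mulrDl mulrDr addrACA. Qed.

Lemma acommC f g : acomm f g = acomm g f.
Proof. exact: addrC. Qed.

Lemma acommDr f g g' : acomm f (g + g') = acomm f g + acomm f g'.
Proof. by rewrite ![acomm f _]acommC acommDl. Qed.

Lemma acommZl c f g : acomm (c *: f) g = c *: acomm f g.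
Proof. by rewrite /acomm scale_lfunAl scale_lfunAr scalerDr. Qed.

Lemma acommZr c f g : acomm f (c *: g) = c *: acomm f g.
Proof. by rewrite ![acomm f _]acommC acommZl. Qed.

(** The factor [1 + c * d] is 0 for [c = d] equal to [im] or [- im], the isotropy of [w_j] and of
    its conjugate, and 2 for [c = - im], [d = im]; the latter explains the one half in [osc_be]. *)
Lemma acomm_osc (c d : K) p q :
  acomm (x0 p + c *: x1 p) (x0 q + d *: x1 q) = ((1 + c * d) * (q == tau p)%:R) *: (1 : 'End(V)).
Proof.
rewrite acommDl !acommDr !acommZl !acommZr /acomm !car /= !scale0r !scaler0 addr0 add0r.
by rewrite !scalerA mulrDl mul1r -scalerDl.
Qed.

Lemma osc_alal p q : osc_al p * osc_al q = - (osc_al q * osc_al p).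
Proof.
apply/eqP; rewrite -addr_eq0; apply/eqP; apply: etrans (acomm_osc im im p q) _.
by rewrite im_sqr subrr mul0r scale0r.
Qed.

Lemma osc_bebe p q : osc_be p * osc_be q = - (osc_be q * osc_be p).
Proof.
apply/eqP; rewrite -addr_eq0; apply/eqP.
change (acomm (osc_be p) (osc_be q) = 0).
rewrite acommZl acommZr -!scaleNr acomm_osc mulrNN im_sqr subrr mul0r scale0r.
by rewrite !scaler0.
Qed.

Lemma osc_beal p q : osc_be p * osc_al q + osc_al q * osc_be p = (p == q)%:R *: (1 : 'End(V)).
Proof.
change (acomm (osc_be p) (osc_al q) = (p == q)%:R *: (1 : 'End(V))).
rewrite acommZl -!scaleNr acomm_osc tauK mulNr im_sqr opprK scalerA mulrA.
by rewrite mulVf // mul1r eq_sym.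
Qed.

Lemma osc_anticomm i p i' q : (i == i') && (q == tau p) = false ->
  x i p * x i' q = - (x i' q * x i p).
Proof. by move=> ne; apply/eqP; rewrite -addr_eq0 car ne scale0r. Qed.

Lemma osc_albe p q : osc_al p * osc_be (tau q) =
  2%:R^-1 *: (x0 p * x0 q + x1 p * x1 q + im *: (x1 p * x0 q - x0 p * x1 q)).
Proof.
rewrite /osc_al /osc_be tauK scale_lfunAr; congr (_ *: _).
rewrite mulrDl !mulrBr !scale_lfunAl !scale_lfunAr scalerA im_sqr scaleN1r opprK.
rewrite scalerBr addrACA [RHS]addrACA; congr (_ + _).
exact: addrC.
Qed.

(** In [osc_albe] the real part is antisymmetric in [p] and [q] and the imaginary part symmetric,
    because all the operators involved anticommute; the difference keeps the real part only. *)
Lemma osc_pair p q : q != tau p ->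
  x0 p * x0 q + x1 p * x1 q = osc_al p * osc_be (tau q) - osc_al q * osc_be (tau p).
Proof.
move=> /negPf qp.
have pq : (p == tau q) = false by rewrite -(inj_eq (can_inj tauK)) tauK eq_sym.
rewrite !osc_albe -scalerBr.
rewrite [x0 q * x0 p]osc_anticomm ?pq ?andbF // [x1 q * x1 p]osc_anticomm ?pq ?andbF //.
rewrite [x1 q * x0 p]osc_anticomm ?pq ?andbF // [x0 q * x1 p]osc_anticomm ?pq ?andbF //.
rewrite opprK [- (x0 p * x1 q) + _]addrC !opprD !opprK addrACA subrr addr0.
by rewrite -mulr2n -scaler_nat scalerA mulVf // scale1r.
Qed.

(** On the diagonal the real part of [osc_albe] consists of squares and vanishes; what remains is
    [- im] times the product, and the factor [im] makes it real. *)
Lemma osc_diag p : tau p != p -> x0 p * x1 p = im *: (osc_al p * osc_be (tau p)).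
Proof.
rewrite eq_sym => /negPf pp.
have sq i : x i p * x i p = 0.
  have := car i p i p; rewrite pp andbF scale0r -mulr2n -scaler_nat => /eqP.
  by rewrite scaler_eq0 (negPf two_neq0) => /eqP.
rewrite osc_albe !sq addr0 add0r [x1 p * _]osc_anticomm //= -opprD -mulr2n scalerN scalerN.
transitivity ((- (im * im) * (2%:R^-1 * 2%:R)) *: (x0 p * x1 p)).
  by rewrite im_sqr opprK mulVf // mulr1 scale1r.
by rewrite -scaler_nat scalerN !scalerA -scaleNr; congr (_ *: _); ring.
Qed.

End Oscillators.

(** * The isomorphism *)

Section Isomorphism.
Variables (R : realType) (s : nat) (G : 'M[R]_(2 * s.+1)) (v : coframe R s).
Notation dimX := (2 * s.+1)%N.
Notation Q := (invmx G).
Notation NN := (s.+1 + s.+1)%N.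
Notation cj := (@conjc R : {rmorphism R[i] -> R[i]}).
Notation e j k := (delta_mx j k : 'M[R[i]]_s.+1).
Hypothesis orth : forall i j i' j',
  (v i j *m Q *m (v i' j')^T) 0 0 = ((i == i') && (j == j'))%:R.
Hypothesis Qu : Q \in unitmx.
Hypothesis hs : (2 <= s)%N.
Implicit Types (f g : 'End(ext R dimX)) (M : 'M[R[i]]_NN).

(** Matches each wedge product, indexed by the first half, with the contraction along the same
    covector, indexed by the second. *)
Definition swap (p : 'I_NN) : 'I_NN :=
  match fintype.split p with inl j => rshift s.+1 j | inr j => lshift s.+1 j end.
Definition real_osc (i : 'I_2) (p : 'I_NN) : 'End(ext R dimX) :=
  match fintype.split p with inl j => E_op v i j | inr j => contract Q (v i j) end.
Definition osc (i : 'I_2) (p : 'I_NN) : 'End(ext R[i] dimX) := complexify (real_osc i p).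

Lemma swap_lshift j : swap (lshift s.+1 j) = rshift s.+1 j.
Proof. by rewrite /swap (unsplitK (inl j : 'I_s.+1 + 'I_s.+1)). Qed.

Lemma swap_rshift j : swap (rshift s.+1 j) = lshift s.+1 j.
Proof. by rewrite /swap (unsplitK (inr j : 'I_s.+1 + 'I_s.+1)). Qed.

Lemma swapK : involutive swap.
Proof.
by move=> p; case: (split_ordP p) => j ->; rewrite ?swap_lshift ?swap_rshift ?swap_lshift.
Qed.

Lemma real_osc_lshift i j : real_osc i (lshift s.+1 j) = E_op v i j.
Proof. by rewrite /real_osc (unsplitK (inl j : 'I_s.+1 + 'I_s.+1)). Qed.

Lemma real_osc_rshift i j : real_osc i (rshift s.+1 j) = contract Q (v i j).
Proof. by rewrite /real_osc (unsplitK (inr j : 'I_s.+1 + 'I_s.+1)). Qed.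

Lemma real_osc_car i p i' q :
  real_osc i p * real_osc i' q + real_osc i' q * real_osc i p
  = ((i == i') && (q == swap p))%:R *: (1 : 'End(ext R dimX)).
Proof.
case: (split_ordP p) => j ->; case: (split_ordP q) => k ->;
  rewrite ?swap_lshift ?swap_rshift ?real_osc_lshift ?real_osc_rshift.
- by rewrite eq_lrshift andbF scale0r [E_op v i j * _]wedge_op_anticomm addNr.
- by rewrite eq_rshift addrC contract_wedge_op orth eq_sym.
- by rewrite eq_lshift contract_wedge_op orth [k == j]eq_sym.
- by rewrite eq_rlshift andbF scale0r contract_anticomm addNr.
Qed.

Lemma complexify_anticomm f g (b : bool) : f * g + g * f = b%:R *: (1 : 'End(ext R dimX)) ->
  complexify f * complexify g + complexify g * complexify f
  = b%:R *: (1 : 'End(ext R[i] dimX)).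
Proof.
move=> fg.
have h1 := congr2 +%R (complexifyM f g) (complexifyM g f).
have h2 := etrans (esym h1) (esym (complexifyD (f * g) (g * f))).
apply: etrans h2 _; apply: etrans (congr1 (@complexify R dimX) fg) _.
apply: etrans (complexifyZ b%:R 1) _; have -> := complexify1 R dimX.
by congr (_ *: _); exact: rmorph_nat.
Qed.

Lemma osc_car i p i' q :
  osc i p * osc i' q + osc i' q * osc i p
  = ((i == i') && (q == swap p))%:R *: (1 : 'End(ext R[i] dimX)).
Proof.
exact: (complexify_anticomm (real_osc_car i p i' q)).
Qed.

Lemma two_neq0 : 2%:R != 0 :> R[i].
Proof. by rewrite pnatr_eq0. Qed.

Lemma imag_mul : imag R * imag R = -1.
Proof. exact: imag_sqr. Qed.

Lemma conj_imag : cj (imag R) = - imag R.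
Proof. by apply/eqP; rewrite eq_complex /= oppr0 !eqxx. Qed.

Lemma conjc_involutive : involutive cj.
Proof. exact: conjcK. Qed.

Lemma conjc_real (r : R) : cj r%:C%C = r%:C%C.
Proof. by apply/eqP; rewrite eq_complex /= oppr0 !eqxx. Qed.

Lemma conjc_fixed (z : R[i]) : cj z = z -> z = (complex.Re z)%:C%C.
Proof.
case: z => x y [] /eqP; rewrite eq_sym -subr_eq0 opprK -mulr2n mulrn_eq0 /= => /eqP ->.
by [].
Qed.

Definition rep : 'M[R[i]]_NN -> 'End(ext R[i] dimX) :=
  quad (osc_al (imag R) osc) (osc_be (imag R) swap osc).

Lemma rep_bracket M M' : rep (commutator M M') = op_bracket (rep M) (rep M').
Proof.
apply: quad_bracket.
- exact: osc_alal imag_mul osc_car.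
- exact: osc_bebe imag_mul osc_car.
- exact: osc_beal imag_mul two_neq0 swapK osc_car.
Qed.

Lemma rep_inj : injective rep.
Proof.
apply: quad_inj.
- exact: osc_alal imag_mul osc_car.
- exact: osc_beal imag_mul two_neq0 swapK osc_car.
apply/eqP => /lfunP/(_ (ext1 _ _)); rewrite one_lfunE zero_lfunE => /ffunP/(_ finset.set0)/eqP.
by rewrite !ffunE eqxx oner_eq0.
Qed.

Lemma repL (c : R[i]) M M' : rep (c *: M + M') = c *: rep M + rep M'.
Proof. exact: quad_linear. Qed.

Lemma repD M M' : rep (M + M') = rep M + rep M'.
Proof. by rewrite -[M]scale1r repL !scale1r. Qed.

Lemma rep0 : rep 0 = 0.
Proof. exact: linear0. Qed.

Lemma repZ (c : R[i]) M : rep (c *: M) = c *: rep M.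
Proof. by rewrite -[c *: M]addr0 repL rep0 addr0. Qed.

Lemma repB M M' : rep (M - M') = rep M - rep M'.
Proof. by rewrite addrC -scaleN1r repL scaleN1r addrC. Qed.

Lemma upper_delta j k : upper (e j k) = delta_mx (lshift s.+1 j) (rshift s.+1 k).
Proof.
apply/matrixP => a b; rewrite /upper; case: (split_ordP a) => a' ->; case: (split_ordP b) => b' ->.
- by rewrite block_mxEul !mxE eq_lshift eq_lrshift andbF.
- by rewrite block_mxEur !mxE eq_lshift eq_rshift.
- by rewrite block_mxEdl !mxE eq_rlshift.
- by rewrite block_mxEdr !mxE eq_rlshift.
Qed.

Lemma lower_delta j k : lower (e j k) = delta_mx (rshift s.+1 j) (lshift s.+1 k).
Proof.
apply/matrixP => a b; rewrite /lower; case: (split_ordP a) => a' ->; case: (split_ordP b) => b' ->.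
- by rewrite block_mxEul !mxE eq_lrshift.
- by rewrite block_mxEur !mxE eq_lrshift.
- by rewrite block_mxEdl !mxE eq_lshift eq_rshift.
- by rewrite block_mxEdr !mxE eq_rlshift andbF.
Qed.

Lemma ord2_sum (V : nmodType) (h : 'I_2 -> V) : \sum_(i < 2) h i = h ord0 + h ord_max.
Proof.
rewrite !big_ord_recl big_ord0 addr0; congr (_ + h _); exact: val_inj.
Qed.

Lemma complexify_osc_pair p q : q != swap p ->
  complexify (real_osc ord0 p * real_osc ord0 q + real_osc ord_max p * real_osc ord_max q)
  = rep (delta_mx p (swap q) - delta_mx q (swap p)).
Proof.
move=> qp.
have cD := complexifyD (real_osc ord0 p * real_osc ord0 q) (real_osc ord_max p * real_osc ord_max q).
have c0 := complexifyM (real_osc ord0 p) (real_osc ord0 q).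
have c1 := complexifyM (real_osc ord_max p) (real_osc ord_max q).
have oscE := osc_pair imag_mul two_neq0 swapK osc_car qp.
have repE := repB (delta_mx p (swap q)) (delta_mx q (swap p)).
have q1 := quad_delta (osc_al (imag R) osc) (osc_be (imag R) swap osc) p (swap q).
have q2 := quad_delta (osc_al (imag R) osc) (osc_be (imag R) swap osc) q (swap p).
have repE' := etrans repE (congr2 (fun x y => x - y) q1 q2).
exact: etrans cD (etrans (congr2 +%R c0 c1) (etrans oscE (esym repE'))).
Qed.

Lemma complexify_osc_diag p : swap p != p ->
  complexify (real_osc ord0 p * real_osc ord_max p) = rep (imag R *: delta_mx p (swap p)).
Proof.
move=> pp.
have cM := complexifyM (real_osc ord0 p) (real_osc ord_max p).
have oscE := osc_diag imag_mul two_neq0 swapK osc_car pp.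
have repE := repZ (imag R) (delta_mx p (swap p)).
have q1 := quad_delta (osc_al (imag R) osc) (osc_be (imag R) swap osc) p (swap p).
exact: etrans cM (etrans oscE (esym (etrans repE (congr1 _ q1)))).
Qed.

Lemma complexify_L_op j k :
  complexify (L_op v j k) = rep (upper (e j k - e k j)).
Proof.
have -> : upper (e j k - e k j) = delta_mx (lshift s.+1 j) (swap (lshift s.+1 k))
    - delta_mx (lshift s.+1 k) (swap (lshift s.+1 j)).
  by rewrite !swap_lshift -!upper_delta addrC -scaleN1r upperL scaleN1r addrC.
apply: etrans (complexify_osc_pair _); last by rewrite swap_lshift eq_lrshift.
by rewrite !real_osc_lshift /L_op ord2_sum.
Qed.

(** Taking adjoints reverses the two factors: hence the exchanged indices of [Lambda_op] here and
    the sign in [complexify_A_op]. *)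
Lemma complexify_Lambda_op j k :
  complexify (Lambda_op G v k j) = rep (lower (e j k - e k j)).
Proof.
have -> : lower (e j k - e k j) = delta_mx (rshift s.+1 j) (swap (rshift s.+1 k))
    - delta_mx (rshift s.+1 k) (swap (rshift s.+1 j)).
  by rewrite !swap_rshift -!lower_delta addrC -scaleN1r lowerL scaleN1r addrC.
apply: etrans (complexify_osc_pair _); last by rewrite swap_rshift eq_rlshift.
by rewrite !real_osc_rshift /Lambda_op ord2_sum.
Qed.

Lemma complexify_V_op j : complexify (V_op v j) = rep (upper (imag R *: e j j)).
Proof.
have -> : upper (imag R *: e j j) = imag R *: delta_mx (lshift s.+1 j) (swap (lshift s.+1 j)).
  by rewrite swap_lshift -upper_delta -[imag R *: e j j]addr0 upperL [upper 0]block_mx0 addr0.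
apply: etrans (complexify_osc_diag _); last by rewrite swap_lshift eq_rlshift.
by rewrite !real_osc_lshift.
Qed.

Lemma complexify_A_op j : complexify (- A_op G v j) = rep (lower (imag R *: e j j)).
Proof.
have -> : lower (imag R *: e j j) = imag R *: delta_mx (rshift s.+1 j) (swap (rshift s.+1 j)).
  by rewrite swap_rshift -lower_delta -[imag R *: e j j]addr0 lowerL [lower 0]block_mx0 addr0.
apply: etrans (complexify_osc_diag _); last by rewrite swap_rshift eq_lrshift.
by rewrite !real_osc_rshift /A_op contract_anticomm opprK.
Qed.

End Isomorphism.

(** * Matching the fibre with the matrix algebra *)

Section Bijection.
Variables (R : realType) (s : nat) (G : 'M[R]_(2 * s.+1)) (v : coframe R s).
Notation dimX := (2 * s.+1)%N.
Notation Q := (invmx G).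
Notation NN := (s.+1 + s.+1)%N.
Notation cj := (@conjc R : {rmorphism R[i] -> R[i]}).
Hypothesis orth : forall i j i' j',
  (v i j *m Q *m (v i' j')^T) 0 0 = ((i == i') && (j == j'))%:R.
Hypothesis Qu : Q \in unitmx.
Hypothesis hs : (2 <= s)%N.
Notation rep := (rep G v).
Notation LR := (LR_fibre G v).
Implicit Types (f g : 'End(ext R dimX)) (M : 'M[R[i]]_NN).

Definition represented f := exists2 M, split_su cj M & complexify f = rep M.

Lemma representedD f g : represented f -> represented g -> represented (f + g).
Proof.
move=> [M sM fM] [M' sM' gM']; exists (M + M'); first exact: split_suD.
exact: etrans (complexifyD f g) (etrans (congr2 +%R fM gM') (esym (repD _ _ M M'))).
Qed.

Lemma representedZ (r : R) f : represented f -> represented (r *: f).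
Proof.
move=> [M sM fM]; exists (r%:C%C *: M); first exact: split_suZ (conjc_real r) sM.
exact: etrans (complexifyZ r f) (etrans (congr1 _ fM) (esym (repZ _ _ _ M))).
Qed.

Lemma represented_bracket f g : represented f -> represented g -> represented (op_bracket f g).
Proof.
move=> [M sM fM] [M' sM' gM']; exists (commutator M M'); first exact: split_su_commutator.
apply: etrans (complexify_bracket f g) _.
exact: etrans (congr2 (@op_bracket _ _) fM gM') (esym (rep_bracket orth M M')).
Qed.

Lemma represented_generator f : lie_generators G v f -> represented f.
Proof.
have cji := conj_imag R.
move/(lie_generatorsP v Qu) => [[j [k [jk [->|->]]]]|[j [->|->]]].
- exists (upper (delta_mx j k - delta_mx k j)); last exact: complexify_L_op.
  exact/split_su_upper/star_skew.
- exists (lower (delta_mx k j - delta_mx j k)); last exact: complexify_Lambda_op.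
  exact/split_su_lower/star_skew.
- exists (upper (imag R *: delta_mx j j)); last exact: complexify_V_op.
  exact/split_su_upper/star_imag.
- rewrite -[A_op G v j]opprK -scaleN1r; apply: representedZ.
  exists (lower (imag R *: delta_mx j j)); last exact: complexify_A_op.
  exact/split_su_lower/star_imag.
Qed.

(** Again by minimality: represented operators form a real Lie subalgebra containing the
    generators. *)
Lemma LR_represented f : LR f -> represented f.
Proof.
move=> fL; apply: (fL represented); split; last exact: represented_generator.
split.
- exists 0; first exact: split_su0.
  exact: etrans (complexify0 R dimX) (esym (rep0 G v)).
- exact: representedD.
- exact: representedZ.
- exact: represented_bracket.
Qed.

(** The predicate to which [split_su_generated] is applied: it is closed under the real Lie
    operations because [LR] is, so surjectivity reduces to the elementary blocks. *)
Definition represents M := exists2 f, LR f & complexify f = rep M.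

Lemma split_su_represents M : split_su cj M -> represents M.
Proof.
have [L0 LD LZ LB] := LR_fibre_subalgebra G v.
have Lgen f : _ -> LR f := fun H => LR_fibre_generators (proj2 (lie_generatorsP v Qu f) H).
have N3 : (2 < s.+1)%N by rewrite ltnS.
move=> sM; apply: (split_su_generated (@conjc_involutive R) (imag_mul R) (conj_imag R) (two_neq0 R) N3 _ _ _ _ _ _ _ _ sM).
- by exists 0 => //; exact: etrans (complexify0 R dimX) (esym (rep0 G v)).
- move=> M1 M2 [f fL fM] [g gL gM]; exists (f + g); first exact: LD.
  exact: etrans (complexifyD f g) (etrans (congr2 +%R fM gM) (esym (repD _ _ M1 M2))).
- move=> r M1 rr [f fL fM]; exists (complex.Re r *: f); first exact: LZ.
  apply: etrans (complexifyZ _ f) _; rewrite -(conjc_fixed rr).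
  exact: etrans (congr1 _ fM) (esym (repZ _ _ _ M1)).
- move=> M1 M2 [f fL fM] [g gL gM]; exists (op_bracket f g); first exact: LB.
  apply: etrans (complexify_bracket f g) _.
  exact: etrans (congr2 (@op_bracket _ _) fM gM) (esym (rep_bracket orth M1 M2)).
- move=> j k jk; exists (L_op v j k); last exact: complexify_L_op.
  by apply: Lgen; left; exists j, k; split=> //; left.
- move=> j; exists (V_op v j); last exact: complexify_V_op.
  by apply: Lgen; right; exists j; left.
- move=> j k jk; exists (Lambda_op G v k j); last exact: complexify_Lambda_op.
  by apply: Lgen; left; exists k, j; split; [rewrite eq_sym | right].
- move=> j; exists (- A_op G v j); last exact: complexify_A_op.
  by rewrite -scaleN1r; apply: LZ; apply: Lgen; right; exists j; right.
Qed.

(** On [LR] the chosen matrix exists by [LR_represented] and is unique by injectivity of [rep]; the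
    default 0 is returned only where there is none. *)
Definition matrix_of f : 'M[R[i]]_NN := xget 0 [set M | split_su cj M /\ complexify f = rep M].

Lemma matrix_ofP f : LR f -> split_su cj (matrix_of f) /\ complexify f = rep (matrix_of f).
Proof.
move=> /LR_represented[M sM fM]; rewrite /matrix_of.
by apply: (@xgetPex _ 0 [set M | split_su cj M /\ complexify f = rep M]); exists M.
Qed.

Lemma matrix_of_eq f M : LR f -> complexify f = rep M -> matrix_of f = M.
Proof.
move=> /matrix_ofP[_ fM] fM'.
exact: (rep_inj orth (etrans (esym fM) fM')).
Qed.

Lemma LR_isomorphic_su : isomorphic_to_su LR s.+1 s.+1.
Proof.
have [L0 LD LZ LB] := LR_fibre_subalgebra G v.
exists (fun f => cayley (matrix_of f)); split.
- split.
  + move=> f /matrix_ofP[/(split_su_cayley _ (two_neq0 R)) sf _]; exact: sf.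
  + move=> f g /set_mem /matrix_ofP[_ fM] /set_mem /matrix_ofP[_ gM].
    move/(can_inj (cayleyK (two_neq0 R))) => fg.
    apply: complexify_inj; apply: etrans fM _; rewrite fg; exact: esym.
  + move=> M sM.
    (* [cayley] is its own inverse, so the preimage of [M] is the operator represented by
       [cayley M]. *)
    have sM' : split_su cj (cayley M).
      by apply/(split_su_cayley _ (two_neq0 R)); rewrite (cayleyK (two_neq0 R)).
    have [f fL fM] := split_su_represents sM'; exists f => //.
    by rewrite (matrix_of_eq fL fM) (cayleyK (two_neq0 R)).
- move=> f g fL gL; rewrite -linearD; congr cayley; apply: matrix_of_eq; first exact: LD.
  have [_ fM] := matrix_ofP fL; have [_ gM] := matrix_ofP gL.
  exact: etrans (complexifyD f g) (etrans (congr2 +%R fM gM) (esym (repD _ _ _ _))).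
- move=> r f fL; rewrite -linearZ; congr cayley; apply: matrix_of_eq; first exact: LZ.
  have [_ fM] := matrix_ofP fL.
  exact: etrans (complexifyZ r f) (etrans (congr1 _ fM) (esym (repZ _ _ _ _))).
- move=> f g fL gL.
  have [_ fM] := matrix_ofP fL; have [_ gM] := matrix_ofP gL.
  have fgM := etrans (complexify_bracket f g)
    (etrans (congr2 (@op_bracket _ _) fM gM) (esym (rep_bracket orth _ _))).
  have mE := matrix_of_eq (LB _ _ fL gL) fgM.
  exact: etrans (congr1 _ mE) (cayley_commutator (two_neq0 R) _ _).
Qed.

End Bijection.

Lemma unitmx_of_pos_def (R : realFieldType) n (G : 'M[R]_n) :
  (forall u : 'rV[R]_n, u != 0 -> 0 < (u *m G *m u^T) 0 0) -> G \in unitmx.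
Proof.
move=> Gpos; rewrite -row_free_unit -kermx_eq0; apply/rowV0P => u /sub_kermxP uG.
by apply/eqP; apply: contraT => /Gpos; rewrite uG mul0mx mxE ltxx.
Qed.

Theorem theorem7p7 (R : realType) (s : nat) (hs : (2 <= s)%N)
    (X : manifold R (2 * s.+1)) (K : almost_sKahler X)
    (c : chart R (2 * s.+1) X) (p : X) (hc : atlas c) (hp : chart_dom c p)
    (v : coframe R s) (hv : adapted_coframe K c p v) :
  let g := metric K c p in
  complexify (n := 2 * s.+1) @` LR_fibre g v
    = LC_fibre g v `&` preserves (pairing2 g v)
  /\ isomorphic_to_su (LR_fibre g v) s.+1 s.+1.
Proof.
move=> g; have [orth _] := hv.
have Qu : invmx g \in unitmx.
  rewrite unitmx_inv; apply: unitmx_of_pos_def.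
  by have [_ /(_ c p hc hp) []] := metric_riemannian K.
split; first exact: LR_fibre_real_form.
exact: LR_isomorphic_su.
Qed.
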